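(* Let $k\in\mathbb{N}$ and $d\geq(k+1)^2$. The Gram spectrahedron $\mathrm{Gram}(f)$ of a generic nonnegative binary form $f\in\mathbb{R}[x,y]_{2d}$ contains a face $F$ which is a simplex, with $(\mathrm{rk}(F),\dim(F))=(2(k+1),k)$, and such that every extreme point of $F$ is an extreme point of $\mathrm{Gram}(f)$ of rank two.
   Context: $\mathbb{N}=\{1,2,3,\dots\}$. $\mathbb{R}[x,y]_m$ denotes the space of real binary forms of degree $m$ (together with $0$). A form $f\in\mathbb{R}[x,y]_{2d}$ is nonnegative if $f(a,b)\ge 0$ for all $(a,b)\in\mathbb{R}^2$. ''For a generic nonnegative binary form $f\in\mathbb{R}[x,y]_{2d}$, property P holds'' means: the set of nonnegative $f\in\mathbb{R}[x,y]_{2d}$ for which P fails is contained in some (algebraic) hypersurface of the real vector space $\mathbb{R}[x,y]_{2d}$. Let $V=\mathbb{R}[x,y]_d$, let $\mathsf{S}_2V\subseteq V\otimes V$ be the space of symmetric tensors (invariant under $p\otimes q\mapsto q\otimes p$) and let $\mu:\mathsf{S}_2V\to\mathbb{R}[x,y]_{2d}$ be the linear map induced by $p\otimes q\mapsto pq$. Every $\theta\in\mathsf{S}_2V$ can be written as $\theta=\sum_{i=1}^r\epsilon_i\,p_i\otimes p_i$ with $\epsilon_i=\pm1$ and $p_1,\dots,p_r\in V$ linearly independent; then $\mathrm{im}(\theta)=\mathrm{span}(p_1,\dots,p_r)$, $\mathrm{rk}(\theta)=r$, and $\theta$ is positive semidefinite (psd) if all $\epsilon_i=1$. The (symmetric)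 Gram spectrahedron is $\mathrm{Gram}(f)=\{\theta\in\mathsf{S}_2V:\theta\text{ psd},\ \mu(\theta)=f\}$. For a nonempty face $F$ of $\mathrm{Gram}(f)$ put $\mathscr{U}(F)=\sum_{\theta\in F}\mathrm{im}(\theta)\subseteq V$ and $\mathrm{rk}(F)=\dim\mathscr{U}(F)$ (this equals $\mathrm{rk}(\theta)$ for every $\theta$ in the relative interior of $F$). *)

(* Defs.v *)
From HB Require Import structures.
From mathcomp Require Import all_boot all_order all_algebra.
From mathcomp Require Import mpoly.
From mathcomp Require Import classical_sets reals.

Set Implicit Arguments.
Unset Strict Implicit.
Unset Printing Implicit Defensive.

Import Order.TTheory GRing.Theory Num.Theory.

Local Open Scope classical_set_scope.
Local Open Scope ring_scope.

Section Convexity.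
Variables (R : realType) (E : vectType R).
Implicit Types (C F : set E) (x y : E).

Definition convex C : Prop :=
  forall x y (t : R), C x -> C y -> 0 <= t <= 1 -> C (t *: x + (1 - t) *: y).

Definition face C F : Prop :=
  [/\ F `<=` C, convex F &
      forall x y (t : R), C x -> C y -> 0 < t < 1 ->
        F (t *: x + (1 - t) *: y) -> F x /\ F y].

Definition extreme C x : Prop :=
  C x /\ forall y z (t : R), C y -> C z -> 0 < t < 1 ->
    x = t *: y + (1 - t) *: z -> y = x /\ z = x.

Definition affinely_independent n (v : 'I_n -> E) : Prop :=
  forall c : 'I_n -> R,
    \sum_i c i = 0 -> \sum_i c i *: v i = 0 -> forall i, c i = 0.

Definition convex_hull n (v : 'I_n -> E) : set E :=
  [set x | exists w : 'I_n -> R,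
    [/\ forall i, 0 <= w i, \sum_i w i = 1 & x = \sum_i w i *: v i]].

Definition simplex F : Prop :=
  exists n (v : 'I_n.+1 -> E), affinely_independent v /\ F = convex_hull v.

(* U is the linear span of the (possibly infinite) set S. *)
Definition spans (S : set E) (U : {vspace E}) : Prop :=
  forall x, x \in U <->
    exists s : seq E, (forall y, y \in s -> S y) /\ x \in <<s>>%VS.

(* The dimension of the affine hull of F, i.e. of its space of directions. *)
Definition has_dim F (n : nat) : Prop :=
  F !=set0 /\
  exists U : {vspace E},
    spans [set z | exists x y, [/\ F x, F y & z = x - y]] U /\ \dim U = n.

End Convexity.

Section BinaryForms.
Variable R : realType.

Definition bform (m : nat) := dhomog 2 R m.

(* x^i y^(m - i); intended for i <= m. *)
Definition bmon (m i : nat) : 'X_{1..2} :=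
  [multinom (if j == ord0 then i else (m - i)%N) | j < 2].

Definition fcoef m (f : bform m) : 'rV[R]_m.+1 :=
  \row_i (f : {mpoly R[2]})@_(bmon m i).

Lemma fpoly_subproof m (c : 'rV[R]_m.+1) :
  \sum_i c 0 i *: 'X_[bmon m i] \is m.-homog.
Proof.
apply: rpred_sum => i _; apply: rpredZ; rewrite dhomogX /= mdegE.
rewrite big_ord_recl big_ord1 !mnmE /= subnKC //.
by rewrite -ltnS ltn_ord.
Qed.

Definition fpoly m (c : 'rV[R]_m.+1) : bform m := DHomog (fpoly_subproof c).

Lemma fcoefK m : cancel (@fcoef m) (@fpoly m).
Proof.
move=> f; apply/val_inj/mpolyP => n /=; rewrite raddf_sum /=.
under eq_bigr do rewrite mcoeffZ mcoeffX mxE.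
have [nm|nm] := eqVneq (mdeg n) m; last first.
  rewrite (dhomog_nemf_coeff (dhomog_is_dhomog f) nm) big1 // => i _.
  case: eqP => [en|]; last by rewrite mulr0.
  by rewrite en (dhomog_nemf_coeff (dhomog_is_dhomog f) nm) mul0r.
have E01 : mdeg n = (n ord0 + n (lift ord0 ord0))%N.
  by rewrite mdegE big_ord_recl big_ord1.
have lt_n : (n ord0 < m.+1)%N by rewrite ltnS -nm E01 leq_addr.
have bn : bmon m (Ordinal lt_n) = n.
  apply/mnmP => j; rewrite mnmE /= -nm E01; case: eqP => [->//|/eqP j0].
  rewrite addKn; congr (n _); apply/val_inj; case: j j0 => [[|[|j]] hj] //=.
rewrite (bigD1 (Ordinal lt_n)) //= bn eqxx mulr1 big1 ?addr0 // => i ni.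
case: eqP => [e|]; last by rewrite mulr0.
case/eqP: ni; apply/val_inj => /=; rewrite -e mnmE eqxx //.
Qed.

Fact fcoef_is_linear m : linear (@fcoef m).
Proof. by move=> a f g; apply/rowP => i; rewrite !mxE mcoeffD mcoeffZ. Qed.

Fact fpoly_is_linear m : linear (@fpoly m).
Proof.
move=> a u v; apply/val_inj; rewrite /= scaler_sumr -big_split /=.
by apply: eq_bigr => i _; rewrite !mxE scalerDl scalerA.
Qed.

HB.instance Definition _ m :=
  GRing.isLinear.Build R (bform m) 'rV[R]_m.+1 _ (@fcoef m) (@fcoef_is_linear m).
HB.instance Definition _ m :=
  GRing.isLinear.Build R 'rV[R]_m.+1 (bform m) _ (@fpoly m) (@fpoly_is_linear m).

Definition nonneg_form m (f : bform m) : Prop :=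
  forall v : 'I_2 -> R, 0 <= (f : {mpoly R[2]}).@[v].

(* A hypersurface of R[x,y]_m is the zero set of a nonconstant polynomial in
   the m + 1 coefficients of a form. *)
Definition generic_nonneg m (P : bform m -> Prop) : Prop :=
  exists Q : {mpoly R[m.+1]}, (1 < msize Q)%N /\
    forall f : bform m, nonneg_form f -> ~ P f -> Q.@[fun i => fcoef f 0 i] = 0.

End BinaryForms.

(* V (x) V for V = R[x,y]_d is the space of matrices 'M[R]_d.+1: the matrix A
   stands for \sum_(i, j) A i j *: (x^i y^(d-i) (x) x^j y^(d-j)), so that
   exchanging the two factors is transposition. *)
Section Gram.
Variables (R : realType) (d : nat).
Notation V := (bform R d).
Implicit Types (p q : V) (theta : 'M[R]_d.+1).

Definition tensor p q : 'M[R]_d.+1 := \matrix_(i, j) (fcoef p 0 i * fcoef q 0 j).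

Definition mu theta : {mpoly R[2]} :=
  \sum_i \sum_j theta i j *: ('X_[bmon d i] * 'X_[bmon d j]).

(* The image of theta under V (x) V = Hom(V^*, V), spanned by the values at
   the dual basis of the monomials; see im_sum_tensor. *)
Definition im theta : {vspace V} :=
  <<[seq fpoly (row i theta) | i <- enum 'I_d.+1]>>%VS.

Definition rk theta : nat := \dim (im theta).

Definition psd theta : Prop :=
  exists r (p : r.-tuple V),
    free p /\ theta = \sum_i tensor (tnth p i) (tnth p i).

Definition Gram (f : bform R (2 * d)) : set 'M[R]_d.+1 :=
  [set theta | [/\ theta^T = theta, psd theta & mu theta = f]].

(* \sum_(theta in F) im theta is the span of the union of the im theta. *)
Definition face_rk (F : set 'M[R]_d.+1) (n : nat) : Prop :=
  exists U : {vspace V},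
    spans [set v | exists theta, F theta /\ v \in im theta] U /\ \dim U = n.

Lemma mu_tensor p q : mu (tensor p q) = (p : {mpoly R[2]}) * (q : {mpoly R[2]}).
Proof.
rewrite -{2}[p]fcoefK -{2}[q]fcoefK /= mulr_suml; apply: eq_bigr => i _.
rewrite mulr_sumr; apply: eq_bigr => j _.
by rewrite mxE -scalerAl -scalerAr scalerA.
Qed.

Lemma im_sum_tensor r (p : r.-tuple V) (e : 'I_r -> R) :
  free p -> (forall i, e i = 1 \/ e i = -1) ->
  im (\sum_i e i *: tensor (tnth p i) (tnth p i)) = <<p>>%VS.
Proof.
move=> fp e1; set M := \sum_i _; set q := tnth p.
have rowM i : fpoly (row i M) = \sum_k (e k * fcoef (q k) 0 i) *: q k.
  rewrite -[RHS]fcoefK (linear_sum (@fcoef R d)); congr (fpoly _); apply/rowP => j.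
  rewrite mxE /M !summxE; apply: eq_bigr => k _.
  by rewrite linearZ /= !mxE mulrA.
have [B AB] : exists B, (\matrix_k fcoef (q k)) *m B = 1%:M.
  apply/row_freeP/inj_row_free => v vA.
  have /freeP/(_ (fun k => v 0 k)) v0 := fp.
  apply/rowP => k; rewrite mxE v0 // -[LHS]fcoefK -[RHS](linear0 (@fpoly R d)).
  congr (fpoly _); rewrite (linear_sum (@fcoef R d)) -[RHS]vA mulmx_sum_row.
  by apply: eq_bigr => l _; rewrite linearZ rowK /q (tnth_nth 0).
apply/eqP; rewrite eqEsubv; apply/andP; split; apply/span_subvP => v.
  case/mapP => i _ ->; rewrite rowM; apply: memv_suml => k _.
  by apply/memvZ/memv_span/mem_tnth.
case/tnthP => l ->.
suff -> : tnth p l = e l *: \sum_i B i l *: fpoly (row i M).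
  apply/memvZ/memv_suml => i _; apply/memvZ/memv_span/map_f.
  by rewrite mem_enum.
under eq_bigr do rewrite rowM scaler_sumr.
rewrite exchange_big /=.
have sumB k : \sum_i B i l *: ((e k * fcoef (q k) 0 i) *: q k) =
    (e k * (k == l)%:R) *: q k.
  have /matrixP/(_ k l) := AB; rewrite !mxE => <-.
  rewrite mulr_sumr scaler_suml; apply: eq_bigr => i _.
  by rewrite scalerA [in RHS]mxE mulrC mulrA.
under eq_bigr do rewrite sumB.
rewrite (bigD1 l) //= [X in _ + X]big1 => [|k /negPf ->]; last first.
  by rewrite mulr0 scale0r.
by rewrite addr0 eqxx mulr1 scalerA; case: (e1 l) => ->;
  rewrite ?mulrNN mulr1 scale1r.
Qed.

End Gram.

(* Main.v *)
Require Import Defs.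
From HB Require Import structures.
From mathcomp Require Import all_boot all_order all_algebra zify ring.
From mathcomp Require Import fingroup perm mpoly complex polyrcf.
From mathcomp Require Import classical_sets reals.

(* Over the complex numbers a generic nonnegative f equals a g g^* for many
   g of degree d, each g choosing one root from every conjugate pair, and
   every such g gives a rank two tensor of Gram(f).  For n = k + 1 factors
   g_0, ..., g_k the products of two elements of {g_i, g_i^*} satisfy the k
   relations g_i g_i^* = g_0 g_0^*, and span a space of dimension at most
   2n^2 + 1 <= 2d + 1.  If there is no further relation, then the tensors psd
   on the span of the g_i, g_i^* and mapped to f are exactly the convex
   combinations of the k + 1 rank two tensors, which form a simplex, and a
   face.

   That there is no further relation is the nonvanishing of a polynomial D in
   the roots; the product of the conjugates of D under the permutations of the
   roots is a polynomial in the coefficients of f.  It remains to find one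
   choice of roots, now arbitrary and not in conjugate pairs, with D <> 0.  This
   is done by induction on n for d = n^2: the new 2n + 1 pairs of roots are
   (x_j, x_j + t), with h and h' the products of the X - x_j and of the
   X - x_j - t, and (g_i, g_i^* ) is replaced by (g_i h, g_i^* h') and completed
   by (g_0 h', g_0^* h).  A relation has the form P h^2 + Q h h' + S h'^2 = 0,
   so that S vanishes at the roots of h and P at those of h'.  As t tends to 0,
   P + Q + S = 0 forces, by induction, P and S into spaces of dimension at most
   2n + 1, in which vanishing at all x_j implies vanishing. *)

Set Implicit Arguments.
Unset Strict Implicit.
Unset Printing Implicit Defensive.

Import Order.TTheory GRing.Theory Num.Theory.

Local Open Scope ring_scope.

(** * Products of two factors *)

Section Products.
Variables (K : idomainType) (n : nat).
Implicit Type G : nat -> bool -> {poly K}.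

Definition pairing G :=
  forall i : 'I_n, G i true * G i false = G 0%N true * G 0%N false.

Definition conj_index (a : 'I_n * bool) := (a.1, ~~ a.2).

(* The products G_a G_b satisfy no linear relation other than those expressed
   by pairing. *)
Definition nondegenerate G := forall c : 'I_n * bool -> 'I_n * bool -> K,
  \sum_a \sum_b c a b *: (G a.1 a.2 * G b.1 b.2) = 0 ->
  forall a b, b != conj_index a -> c a b + c b a = 0.

(* None stands for the common value of the products G_i true * G_i false. *)
Definition product_index : finType := option ('I_n * 'I_n * bool).

(** The order of [i] and [j] encodes the relation of the two signs: equal for i <= j, opposite for i
    > j. Thus n^2 index pairs and one sign enumerate each unordered pair of non-conjugate factors
    once. *)
Definition signed_pair (i j : 'I_n) b : ('I_n * bool) * ('I_n * bool) :=
  ((i, b), (j, b (+) (j < i)%N)).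

Definition product_at G (x : product_index) : {poly K} :=
  if x is Some (i, j, b) then G i b * G j (b (+) (j < i)%N)
  else G 0%N true * G 0%N false.

Definition pair_index (a b : 'I_n * bool) : product_index :=
  if (a.1 < b.1)%N then
    if a.2 == b.2 then Some (a.1, b.1, a.2) else Some (b.1, a.1, b.2)
  else if (b.1 < a.1)%N then
    if a.2 == b.2 then Some (b.1, a.1, a.2) else Some (a.1, b.1, a.2)
  else if a.2 == b.2 then Some (a.1, a.1, a.2) else None.

Lemma card_product_index : #|product_index| = (2 * n ^ 2).+1.
Proof. by rewrite card_option !card_prod card_ord card_bool muln2 mul2n mulnn. Qed.

Lemma product_at_pair_index G a b : pairing G ->
  product_at G (pair_index a b) = G a.1 a.2 * G b.1 b.2.
Proof.
case: a b => [i b] [j b'] pG; rewrite /pair_index /=.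
case: (ltngtP i j) => [ij|ji|/val_inj <-] /=.
- case: eqP => [<-|] /=; first by rewrite ltnNge (ltnW ij) addbF.
  by rewrite ij mulrC; case: b b' => [] [].
- case: eqP => [<-|] /=; first by rewrite ltnNge (ltnW ji) addbF mulrC.
  by rewrite ji; case: b b' => [] [].
case: eqP => [<-|] /=; first by rewrite ltnn addbF.
by case: b b' => [] [] // _; rewrite -(pG i) // mulrC.
Qed.

Lemma pair_indexC a b : pair_index a b = pair_index b a.
Proof.
case: a b => [i b] [j b']; rewrite /pair_index /= [b' == b]eq_sym.
by case: (ltngtP i j) => [ij|ji|/val_inj <-] //=; case: eqP => // <-.
Qed.

Lemma pair_index_signed_pair i j b : pair_index (signed_pair i j b).1 (signed_pair i
  j b).2 = Some (i, j, b).
Proof.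
rewrite /signed_pair /pair_index /=; case: (ltngtP i j) => [ij|ji|/val_inj <-] /=;
  by rewrite ?addbF ?eqxx //; case: b.
Qed.

Lemma pair_index_inj a b a' b' : b != conj_index a ->
  pair_index a b = pair_index a' b' ->
  (a', b') = (a, b) \/ (a', b') = (b, a).
Proof.
move: a b a' b' => [i b] [j c] [i' b'] [j' c'].
rewrite /pair_index /conj_index xpair_eqE /= => h.
have neg (x y : bool) : x != y -> y = ~~ x by case: x; case: y.
case: (ltngtP i j) h => [ij|ij|/val_inj ej] h;
case: (ltngtP i' j') => [ij'|ij'|/val_inj ej'];
case: (eqVneq b c) h => [eb|/neg eb] h; case: (eqVneq b' c') => [eb'|/neg eb'] // E;
  try (injection E; intros); subst; rewrite ?negbK ?eqxx // in h *;
    try by [left | right].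
all: try by move: (ltn_trans ij ij'); rewrite ltnn.
all: try by move: ij'; rewrite ltnn.
all: try by move: ij; rewrite ltnn.
by move: H => /negb_inj ->; left.
Qed.

(** Each row holds the coefficients of degree at most 2n^2 of one product. For factors of degree n^2
    nothing is cut off, and 2n^2 + 1 products make the matrix square. *)
Definition product_mx G : 'M[K]_#|product_index| :=
  \matrix_(r, s) (product_at G (enum_val r))`_s.

Lemma sum_pair_index G (c : 'I_n * bool -> 'I_n * bool -> K) : pairing G ->
  \sum_a \sum_b c a b *: (G a.1 a.2 * G b.1 b.2) =
  \sum_x (\sum_(p | pair_index p.1 p.2 == x) c p.1 p.2) *: product_at G x.
Proof.
move=> pG; rewrite pair_big /= (partition_big (fun p => pair_index p.1 p.2) predT) //=.
apply: eq_bigr => x _; rewrite scaler_suml; apply: eq_bigr => p /eqP <-.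
by rewrite product_at_pair_index.
Qed.

(** Collecting a relation along the fibres of [pair_index] gives a vector in the left kernel, hence
    zero. The fibre of a non-conjugate pair consists of (a, b) and (b, a) only, so its entry is c a
    b + c b a, or c a a when a = b. *)
Lemma nondegenerate_det G : pairing G -> \det (product_mx G) != 0 -> nondegenerate G.
Proof.
move=> pG dG c; rewrite sum_pair_index // => c0.
pose v : 'rV[K]_#|product_index| :=
  \row_r (\sum_(p | pair_index p.1 p.2 == enum_val r) c p.1 p.2).
have vA : v *m product_mx G = 0.
  apply/rowP => s; rewrite !mxE -[RHS](coef0 K s) -c0 coef_sum.
  rewrite [RHS](reindex _ (onW_bij _ (enum_val_bij product_index))) /=.
  by apply: eq_bigr => r _; rewrite !mxE coefZ.
have v0 : v = 0.
  apply/eqP/negP => nv; move/negP: dG; apply; apply/det0P; exists v => //.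
  exact/negP.
move=> a b ab; have := congr1 (fun w : 'rV_#|product_index| => w 0 (enum_rank
  (pair_index a b))) v0.
rewrite !mxE enum_rankK (bigD1 (a, b)) //=.
have [<-|nab] := eqVneq a b.
  rewrite big1 ?addr0 => [->|p /andP[/eqP hp np]]; first by rewrite addr0.
  have ab' : a != conj_index a by case: a {np hp ab} => i b0;
    rewrite /conj_index xpair_eqE /=; case: b0; rewrite andbF.
  by case: (pair_index_inj ab' (esym hp)) np; rewrite -surjective_pairing => ->;
    rewrite eqxx.
rewrite (bigD1 (b, a)) /=; last first.
  by rewrite pair_indexC eqxx xpair_eqE eq_sym negb_and nab.
rewrite big1 ?addr0 // => p /andP[/andP[/eqP hp np]] np'.
by case: (pair_index_inj ab (esym hp)) np np'; rewrite -surjective_pairing => ->;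
  rewrite eqxx.
Qed.

End Products.

(** * Kernel vectors, primitive relations and separating points *)

Lemma product_mx_kernel (K : idomainType) n (G : nat -> bool -> {poly K}) :
    (forall x : product_index n, (size (product_at G x) <= #|product_index n|)%N) ->
    \det (product_mx n G) = 0 ->
  exists c : product_index n ->
    K, (exists x, c x != 0) /\ \sum_x c x *: product_at G x = 0.
Proof.
move=> sG /eqP/det0P[v v0 vA].
exists (fun x => v 0 (enum_rank x)); split.
  by case/rV0Pn: v0 => r vr; exists (enum_val r); rewrite enum_valK.
apply/polyP => s; rewrite coef0 coef_sum.
(* The size bound makes all coefficients beyond the columns of the matrix vanish, so a kernel vector
   is a relation between the full products. *)
have [sn|sn] := ltnP s #|product_index n|; last first.
  rewrite big1 // => x _; rewrite coefZ nth_default ?mulr0 //.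
  exact: leq_trans (sG x) sn.
have /rowP/(_ (Ordinal sn)) := vA; rewrite !mxE => vs; apply: etrans vs.
rewrite [LHS](reindex _ (onW_bij _ (enum_val_bij (product_index n)))) /=.
by apply: eq_bigr => r _; rewrite !mxE coefZ enum_valK.
Qed.

(** As long as all coefficients vanish at 0, the inner variable can be divided out of the whole
    relation; the size of a nonzero coefficient drops each time, so the process stops. *)
Lemma primitive_relation (K : fieldType) (I : finType) (p : I -> {poly {poly K}})
    (c : I -> {poly K}) :
    (exists x, c x != 0) -> \sum_x c x *: p x = 0 ->
  exists c' : I -> {poly K},
    (exists x, (c' x).[0] != 0) /\ \sum_x c' x *: p x = 0.
Proof.
case=> x; move: {2}(size (c x)) (leqnn (size (c x))) => m.
elim: m c => [|m IHm] c; first by rewrite leqn0 size_poly_eq0 => /eqP->; rewrite eqxx.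
move=> sc cx c0; have [[y cy]|] :=
  @altP (exists y, (c y).[0] != 0) [exists y, (c y).[0] != 0] (existsP).
  by exists c; split => //; exists y.
rewrite negb_exists => /forallP c00.
have fc y : {q | c y = q * 'X}.
  have /factor_theorem/sig_eqW[q ->] : root (c y) 0 by rewrite rootE; move: (c00 y);
    rewrite negbK.
  by exists q; rewrite subr0.
pose c1 y := sval (fc y); have Ec y : c y = c1 y * 'X by rewrite /c1; case: (fc y).
apply: (IHm c1).
- by move: sc cx; rewrite Ec mulf_eq0 negb_or => sc /andP[c1x _]; move: sc;
  rewrite size_mulX.
- by move: cx; rewrite Ec mulf_eq0 negb_or => /andP[].
apply: (mulfI (_ : ('X%:P : {poly {poly K}}) != 0)).
  by rewrite polyC_eq0 polyX_eq0.
rewrite mulr0; apply: etrans c0; rewrite mulr_sumr; apply: eq_bigr => y _.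
by rewrite Ec mul_polyC scalerA mulrC.
Qed.

Lemma poly_nonroot (K : numDomainType) (p : {poly K}) : p != 0 -> exists x, p.[x] != 0.
Proof.
move=> p0; pose rs := [seq i%:R : K | i <- iota 0 (size p)].
have /allPn[x _ px] : ~~ all (root p) rs.
  apply/negP => /(max_poly_roots p0) h; have := h _.
  rewrite size_map size_iota ltnn map_inj_uniq ?iota_uniq => [/(_ isT)//|i j /eqP].
  by rewrite eqr_nat => /eqP.
by exists x.
Qed.

Definition lincomb (K : nzRingType) (L : seq {poly K}) (p : {poly K}) :=
  exists w : nat -> K, p = \sum_(i < size L) w i *: L`_i.

Lemma lincombD (K : nzRingType) (L : seq {poly K}) p q :
  lincomb L p -> lincomb L q -> lincomb L (p + q).
Proof.
case=> w -> [w' ->]; exists (fun i => w i + w' i); rewrite -big_split /=.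
by apply: eq_bigr => i _; rewrite scalerDl.
Qed.

Lemma lincombZ (K : nzRingType) (L : seq {poly K}) a p :
  lincomb L p -> lincomb L (a *: p).
Proof.
case=> w ->; exists (fun i => a * w i); rewrite scaler_sumr.
by apply: eq_bigr => i _; rewrite scalerA.
Qed.

Lemma lincomb0 (K : nzRingType) (L : seq {poly K}) : lincomb L 0.
Proof. by exists (fun=> 0); rewrite big1 // => i _; rewrite scale0r. Qed.

Lemma lincomb_mem (K : nzRingType) (L : seq {poly K}) p : p \in L -> lincomb L p.
Proof.
move=> pL; exists (fun i => (i == index p L)%:R).
have lt : (index p L < size L)%N by rewrite index_mem.
rewrite (bigD1 (Ordinal lt)) //= eqxx scale1r nth_index // big1 ?addr0 // => i ni.
by rewrite -val_eqE /= in ni; rewrite (negPf ni) scale0r.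
Qed.

Lemma lincomb_sum (K : nzRingType) (L : seq {poly K}) (I : finType) (P : pred I) F :
  (forall i, P i -> lincomb L (F i)) -> lincomb L (\sum_(i | P i) F i).
Proof. by move=> h; elim/big_ind: _ => //; [exact: lincomb0 | exact: lincombD]. Qed.

(** One point x is chosen at which a nonzero member of each list does not vanish; subtracting its
    multiples makes every member vanish at x and turns the pivot itself into 0. Counting nonzero
    members instead of lengths lets the lists keep their shape during the induction. *)
Lemma separating_points (K : numFieldType) m (L1 L2 : seq {poly K}) :
    (count (fun p => p != 0%R) L1 <= m)%N -> (count (fun p => p != 0%R) L2 <= m)%N ->
  exists s : m.-tuple K, forall L p, L = L1 \/ L = L2 -> lincomb L p ->
    (forall x, x \in s -> p.[x] = 0) -> p = 0.
Proof.
have lin0 (L : seq {poly K}) p : (count (fun p => p != 0%R) L <= 0)%N ->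
  lincomb L p -> p = 0.
  rewrite leqNgt -has_count -all_predC => /allP aL [w ->]; rewrite big1 // => i _.
  by have := aL L`_i (mem_nth _ (ltn_ord i)); rewrite /= negbK => /eqP->;
    rewrite scaler0.
have piv (L : seq {poly K}) : exists q : {poly K},
  q != 0 /\ ((q \in L) \/ count (fun p => p != 0%R) L = 0%N).
  case: (altP (@hasP _ (fun p : {poly K} => p != 0%R) L)) => [[q qL q0]|nL];
    first by exists q; split; [|left].
  (* A list of zeros needs no pivot; 1 is a placeholder without roots. *)
  by exists 1; rewrite oner_neq0; split=> //; right; apply/eqP;
    rewrite -leqn0 leqNgt -has_count.
elim: m L1 L2 => [|m IHm] L1 L2 c1 c2.
  exists [tuple] => L p LL pL _; apply: (lin0 L) => //; by case: LL => ->.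
have [q1 [q10 L1q]] := piv L1; have [q2 [q20 L2q]] := piv L2.
have [x] := @poly_nonroot _ (q1 * q2) (mulf_neq0 q10 q20).
rewrite hornerM mulf_eq0 negb_or => /andP[q1x q2x].
pose red q L := [seq p - (p.[x] / q.[x]) *: q | p : {poly K} <- L].
have cred q L : q != 0 -> q.[x] != 0 ->
  (q \in L) \/ count (fun p => p != 0%R) L = 0%N ->
    (count (fun p => p != 0%R) L <= m.+1)%N ->
      (count (fun p => p != 0%R) (red q L) <= m)%N.
  move=> q0 qx [qL|cL _]; last first.
    suff -> : red q L = L by rewrite cL.
    have /allP aL : all (fun p => p == 0) L.
      by rewrite -[all _ _]negbK -has_predC has_count -leqNgt /= leqn0; apply/eqP.
    rewrite -[RHS]map_id; apply/eq_in_map => p /aL/eqP->.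
    by rewrite horner0 mul0r scale0r subr0.
  move=> cL; rewrite -ltnS; apply: leq_trans cL; rewrite /red count_map /preim.
  elim: L qL => // p L IHL; rewrite inE /=; case: eqVneq => [<- _|_ /= /IHL lt].
    rewrite divff // scale1r subrr eqxx q0 !add0n add1n ltnS.
    apply: sub_count => r /=; apply: contra_neq => ->.
    by rewrite horner0 mul0r scale0r subr0.
  rewrite -addnS leq_add //; case: (eqVneq p 0) => [->|_]; last exact: leq_b1.
  by rewrite horner0 mul0r scale0r subr0 eqxx.
have [s sP] := IHm _ _ (cred q1 L1 q10 q1x L1q c1) (cred q2 L2 q20 q2x L2q c2).
exists [tuple of x :: s] => L p LL [w pE] ps.
have px : p.[x] = 0 by apply: ps; rewrite mem_head.
(* Since p vanishes at x, the multiples of q subtracted by the reduction cancel, and p is the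
   combination of the reduced list with the same weights. *)
have lr q : lincomb (red q L) p.
  exists w; rewrite size_map;
    under eq_bigr => i _ do rewrite (nth_map 0) // scalerBr scalerA.
  rewrite sumrB -pE -scaler_suml; set a := \sum_(i < _) _.
  suff -> : a = 0 by rewrite scale0r subr0.
  rewrite -(mul0r q.[x]^-1) -px pE horner_sum mulr_suml; apply: eq_bigr => i _.
  by rewrite hornerZ mulrA.
have ps' y : y \in s -> p.[y] = 0 by move=> ys; apply: ps; rewrite inE ys orbT.
by case: LL => LE; subst L; [apply: (sP (red q1 L1)) | apply: (sP (red q2 L2))]; auto.
Qed.

(** * Adding one factor *)

Section Extension.
Variables (K : numFieldType) (k : nat) (G : nat -> bool -> {poly K}).
Hypothesis ndG : nondegenerate k.+1 G.
Hypothesis f_neq0 : G 0%N true * G 0%N false != 0.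

(** The old factors that get multiplied by [perturbed b] are the [G j b] and, from the last index,
    [G 0 (~~ b)]. Listed are their pairwise products involving a factor of index 0. The length 2(k +
    1) + 1 of the list is the number of new root pairs. *)
Definition mixed_products b : seq {poly K} :=
  [seq G 0%N b * G j b | j <- iota 0 k.+1] ++
  [seq G 0%N (~~ b) * G j b | j <- iota 0 k.+1] ++ [:: G 0%N (~~ b) * G 0%N (~~ b)].

Variable s : seq K.
Hypothesis sP : forall b p, lincomb (mixed_products b) p ->
  (forall x, x \in s -> p.[x] = 0) -> p = 0.

Definition perturbed (b : bool) : {poly {poly K}} :=
  \prod_(x <- s) ('X - (x%:P + (if b then 'X else 0))%:P).

(* The first k + 1 factors G i b are multiplied by h or h', the last one is
   obtained from G 0 b by the opposite choice; h' is the translate of h by the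
   indeterminate t of the inner polynomial ring. *)
Definition extension (i : nat) (b : bool) : {poly {poly K}} :=
  map_poly polyC (G (if (i < k.+1)%N then i else 0%N) b) *
  perturbed (b (+) (i == k.+1)).

Local Notation S := ('I_k.+2 * bool)%type.

(** [rho a] is the old factor underlying the new factor [a], the last index lying over 0; [e a]
    tells which multiplier it receives, h for false and h' for true. *)
Let rho (a : S) : 'I_k.+1 * bool := (insubd ord0 (val a.1), a.2).
Let e (a : S) := a.2 (+) (a.1 == k.+1 :> nat).
Let g (a : S) := G (rho a).1 (rho a).2.

Let extension_g (a : S) : extension a.1 a.2 = map_poly polyC (g a) * perturbed (e a).
Proof. by rewrite /extension /g /rho /= val_insubd. Qed.

Let rho_inj a a' : rho a = rho a' -> e a = e a' -> a = a'.
Proof.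
case: a a' => [[i hi] b] [[j hj] b']; rewrite /rho /e /= => -[/(congr1 val)].
rewrite !val_insubd /= => + <-.
case: (ltnP i k.+1) => ik; case: (ltnP j k.+1) => jk.
- by move=> ij _; congr (_, _); apply/val_inj.
- have -> : j == k.+1 by rewrite eqn_leq jk -ltnS hj.
  by rewrite (ltn_eqF ik) => _; case: b.
- have -> : i == k.+1 by rewrite eqn_leq ik -ltnS hi.
  by rewrite (ltn_eqF jk) => _; case: b.
have ei : i = k.+1 by apply/eqP; rewrite eqn_leq ik -ltnS hi.
have ej : j = k.+1 by apply/eqP; rewrite eqn_leq jk -ltnS hj.
by move=> _ _; congr (_, _); apply/val_inj; rewrite /= ei ej.
Qed.

(** Only the last index combines an old factor with the multiplier of the opposite sign, and it lies
    over 0. *)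
Let rhoNe a : rho a != (ord0, ~~ e a) ->
  a = (widen_ord (leqnSn _) (rho a).1, e a) /\ (rho a).2 = e a.
Proof.
case: a => [[i hi] b]; rewrite /rho /e xpair_eqE /= -val_eqE /= val_insubd /=.
case: (ltnP i k.+1) => ik.
  rewrite (ltn_eqF ik) addbF => _; split=> //.
  by congr (_, _); apply/val_inj; rewrite /= val_insubd ik.
have -> : i == k.+1 by rewrite eqn_leq ik -ltnS hi.
by rewrite addbT negbK !eqxx.
Qed.

Lemma horner0_perturbed b : map_poly (horner_eval 0) (perturbed b) = \prod_(x <- s)
  ('X - x%:P).
Proof.
rewrite rmorph_prod; apply: eq_bigr => x _; rewrite rmorphB /= map_polyX map_polyC /=.
by rewrite horner_evalE hornerD hornerC; case: b; rewrite ?hornerX ?horner0 addr0.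
Qed.

Let perturbed_root b x : x \in s ->
  (perturbed (~~ b)).[x%:P + (if ~~ b then 'X else 0)] = 0.
Proof.
move=> xs; apply/eqP; rewrite /perturbed horner_prod; rewrite prodf_seq_eq0;
  apply/hasP; exists x => //=.
by rewrite hornerXsubC subrr.
Qed.

Let perturbed_nonroot b x : (perturbed b).[x%:P + (if ~~ b then 'X else 0)] != 0.
Proof.
rewrite /perturbed horner_prod; rewrite prodf_seq_neq0; apply/allP => y _;
  rewrite hornerXsubC /=.
(* Exactly one of the evaluation point and the root contains t, so their difference has
   t-coefficient 1 or -1. *)
apply/eqP => /(congr1 (fun p : {poly K} => p`_1)).
rewrite coefB !coefD !coefC; case: b; rewrite /= ?coefX ?coef0 /= !add0r ?subr0 ?sub0r.
  by move/eqP; rewrite oppr_eq0 oner_eq0.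
by move/eqP; rewrite oner_eq0.
Qed.

Variable c : S -> S -> {poly K}.
Hypothesis cE : \sum_a \sum_b c a b *: (extension a.1 a.2 * extension b.1 b.2) = 0.

Let D a b := (c a b + c b a).[0].
Let DC a b : D a b = D b a. Proof. by rewrite /D addrC. Qed.

Let rel : \sum_(p : S * S) c p.1 p.2 *: (map_poly polyC (g p.1 * g p.2) * (perturbed
  (e p.1) * perturbed (e p.2))) = 0.
Proof.
rewrite -[RHS]cE pair_big /=; apply: eq_bigr => p _.
by rewrite !extension_g rmorphM /= mulrACA.
Qed.

Let sum_sym (P : pred (S * S)) : (forall p, P (p.2, p.1) = P p) ->
  \sum_(p | P p) D p.1 p.2 *: (g p.1 * g p.2) =
  (\sum_(p | P p) (c p.1 p.2).[0] *: (g p.1 * g p.2)) *+ 2.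
Proof.
move=> Psym; under eq_bigr do rewrite /D hornerD scalerDl.
rewrite big_split /= mulr2n; congr (_ + _).
rewrite [RHS](reindex_inj (inv_inj (_ : involutive (fun p : S * S => (p.2,
  p.1))))) /=; last by case.
by apply: eq_big => [p|p _]; rewrite ?Psym // mulrC.
Qed.

(** At t = 0 both multipliers become h, and h^2 cancels from the relation. *)
Let total0 : \sum_p D p.1 p.2 *: (g p.1 * g p.2) = 0.
Proof.
rewrite sum_sym // -[RHS](mul0rn _ 2); congr (_ *+ 2);
  have := congr1 (map_poly (horner_eval 0)) rel.
rewrite rmorph_sum rmorph0 /=; set h := \prod_(x <- s) ('X - x%:P).
have h0 : h != 0 by rewrite prodf_seq_neq0; apply/allP => x _ /=; rewrite polyXsubC_eq0.
move=> r0; apply: (mulIf (_ : h * h != 0)); first by rewrite mulf_neq0.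
rewrite mul0r; apply: etrans r0; rewrite mulr_suml; apply: eq_bigr => p _.
rewrite map_polyZ /= rmorphM /= [map_poly _ (perturbed _ * _)]rmorphM /=
  !horner0_perturbed -/h -map_poly_comp.
rewrite map_poly_id ?scalerAl // => x _ /=; exact: hornerC.
Qed.

(** The sums of [D] over the fibres of [rho] are the coefficients of a relation between products of
    old factors, to which the nondegeneracy of [G] applies; they are symmetric, so twice each of
    them vanishes. *)
Let fiber0 al be : be != conj_index al ->
  \sum_(p | (rho p.1 == al) && (rho p.2 == be)) D p.1 p.2 = 0.
Proof.
pose d al be := \sum_(p : S * S | (rho p.1 == al) && (rho p.2 == be)) D p.1 p.2.
have dC x y : d x y = d y x.
  rewrite /d (reindex_inj (inv_inj (_ : involutive (fun p : S * S => (p.2,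
    p.1))))) /=; last by case.
  by apply: eq_big => [p|p _]; rewrite 1?andbC // DC.
have d0 : \sum_a \sum_b d a b *: (G a.1 a.2 * G b.1 b.2) = 0.
  rewrite -[RHS]total0 pair_big /= [RHS](partition_big (fun p => (rho p.1,
    rho p.2)) predT) //=.
  apply: eq_bigr => -[a b] _; rewrite /d scaler_suml;
    apply: eq_big => [p|p /andP[/eqP<- /eqP<-]] //.
by move=> ab; have /eqP := ndG d0 ab; rewrite [d be al]dC -mulr2n mulrn_eq0 => /eqP.
Qed.

Let rho_pos a a' : rho a' = rho a -> (rho a).1 != ord0 -> a' = a.
Proof.
move=> ra r0; have ne (a1 : S) : rho a1 = rho a -> (rho a1).2 = e a1.
  move=> r1; apply: (proj2 (rhoNe _)); rewrite r1.
  by apply: contraNneq r0 => ->.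
by apply: rho_inj; rewrite // -(ne a') // -(ne a) // ra.
Qed.

(** If (a, b) and possibly (b, a) are the only members of a fibre that can contribute, the vanishing
    fibre sum is [D a b] or twice it. *)
Let fiber_pick a b : rho b != conj_index (rho a) ->
  (forall p, rho p.1 = rho a -> rho p.2 = rho b -> p <> (a, b) -> p <> (b, a) ->
     D p.1 p.2 = 0) -> D a b = 0.
Proof.
move=> /fiber0 + z; rewrite (bigD1 (a, b)) ?eqxx //=.
have [ab|ab] := boolP ((rho b == rho a) && (rho a == rho b) && ((b, a) != (a, b))).
  rewrite (bigD1 (b, a)) //= big1 => [|p /andP[/andP[/andP[/eqP p1 /eqP p2] /eqP pn
    /eqP pn']]].
    by move/eqP; rewrite addr0 DC -mulr2n mulrn_eq0 => /eqP.
  exact: z.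
rewrite big1 ?addr0 // => p /andP[/andP[/eqP p1 /eqP p2] /eqP pn]; apply: z => // pE.
rewrite pE in p1 p2 pn; case/negP: ab.
by apply/andP; split; [apply/andP; split; apply/eqP | apply/eqP].
Qed.

Let blockP b p := ((e p.1 == b) && (e p.2 == b)).

(** [rho] is injective away from index 0, so a pair in the block with both indices nonzero is alone
    in its fibre and has coefficient 0. Only the mixed products remain. *)
Let block_mixed b : lincomb (mixed_products b) (\sum_(p | blockP b p) D p.1 p.2 *: (g
  p.1 * g p.2)).
Proof.
have g0 a : e a = b -> rho a = (ord0, ~~ b) -> g a = G 0%N (~~ b) by rewrite /g => _ ->.
have gN a : e a = b -> rho a != (ord0, ~~ b) ->
  g a = G (rho a).1 b /\ rho a = ((rho a).1, b).
  move=> ea; rewrite -ea => /rhoNe[_ r2]; rewrite /g r2; split=> //.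
  by rewrite -r2 -surjective_pairing.
have m1 (j : 'I_k.+1) : G 0%N b * G j b \in mixed_products b.
  by rewrite mem_cat; apply/orP; left; apply/mapP; exists (val j);
    rewrite // mem_iota ltn_ord.
have m2 (j : 'I_k.+1) : G 0%N (~~ b) * G j b \in mixed_products b.
  rewrite !mem_cat; apply/or3P/Or32/mapP; exists (val j);
    by rewrite // mem_iota ltn_ord.
have m3 : G 0%N (~~ b) * G 0%N (~~ b) \in mixed_products b.
  by rewrite !mem_cat mem_head !orbT.
apply: lincomb_sum => -[a a'] /andP[/= /eqP ea /eqP ea'].
have [ra|ra] := eqVneq (rho a) (ord0, ~~ b).
  apply/lincombZ/lincomb_mem; rewrite (g0 a) //.
  have [ra'|/(gN _ ea')[-> _]//] := eqVneq (rho a') (ord0, ~~ b); by rewrite (g0 a').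
have [-> Ea] := gN _ ea ra.
have [ra'|ra'] := eqVneq (rho a') (ord0, ~~ b).
  by apply/lincombZ/lincomb_mem; rewrite mulrC (g0 a').
have [-> Ea'] := gN _ ea' ra'.
have [-> | i0] := eqVneq (rho a).1 ord0; first exact/lincombZ/lincomb_mem.
have [-> | j0] := eqVneq (rho a').1 ord0; first by rewrite mulrC;
  exact/lincombZ/lincomb_mem.
rewrite fiber_pick ?scale0r; first exact: lincomb0.
  by rewrite Ea Ea' xpair_eqE; case: (b); rewrite andbF.
move=> [p1 p2] /= /rho_pos r1 /rho_pos r2 pn.
by case: pn; rewrite r1 // r2.
Qed.

(** At a root y of the opposite multiplier every term outside the block vanishes. Cancelling the
    square of [perturbed b] at y and putting t = 0, where y becomes x, shows that the block sum
    vanishes at each x in [s]; being a combination of mixed products, it is 0. *)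
Let block0 b : \sum_(p | blockP b p) D p.1 p.2 *: (g p.1 * g p.2) = 0.
Proof.
apply: (sP (block_mixed b)) => x xs.
rewrite sum_sym ?hornerMn; last by move=> p; rewrite /blockP andbC.
set y := x%:P + (if ~~ b then 'X else 0 : {poly K}).
have y0 : y.[0] = x by rewrite hornerD hornerC; case: (b) => /=;
  rewrite ?hornerX ?horner0 addr0.
have /(congr1 (fun p => p.[y])) := rel.
rewrite horner0 horner_sum (bigID (blockP b)) /= [X in _ + X]big1 => [|p]; last first.
  rewrite /blockP => nb; rewrite hornerZ !hornerM.
  have ne q : e q != b -> (perturbed (e q)).[y] = 0.
    move=> eq; have -> : e q = ~~ b by case: (e q) (b) eq => [] [].
    exact: perturbed_root.
  by case/nandP: nb => /ne ->; rewrite ?(mul0r, mulr0).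
rewrite addr0 => r0.
have {}r0 : \sum_(p | blockP b p) c p.1 p.2 * (map_poly polyC (g p.1 * g p.2)).[y] = 0.
  apply: (mulIf (_ : (perturbed b).[y] * (perturbed b).[y] != 0)).
    by rewrite mulf_neq0 // perturbed_nonroot.
  rewrite mul0r; apply: etrans r0; rewrite mulr_suml;
    apply: eq_bigr => p /andP[/eqP-> /eqP->].
  by rewrite hornerZ !hornerM -!mulrA.
apply/eqP; rewrite mulrn_eq0; apply/eqP.
have /(congr1 (fun p => p.[0])) := r0; rewrite horner0 horner_sum => r1.
apply: etrans r1; rewrite horner_sum; apply: eq_bigr => p _.
rewrite hornerZ [RHS]hornerM; congr (_ * _).
elim/poly_ind: (g p.1 * g p.2) => [|q a IHq]; first by rewrite rmorph0 !horner0.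
rewrite rmorphD rmorphM /= map_polyX map_polyC /= !(hornerD, hornerMX, hornerC) IHq.
by rewrite hornerM y0.
Qed.

Let conj_index_e a a' : e a = e a' -> rho a' = conj_index (rho a) -> (rho a).1 = ord0.
Proof.
move=> ee ra; have [->//|/rhoNe[_ r2]] := eqVneq (rho a) (ord0, ~~ e a).
have [|/rhoNe[_]] := eqVneq (rho a') (ord0, ~~ e a'); first by rewrite ra => -[].
by rewrite ra -ee /conj_index -r2 /=; case: a.2.
Qed.

(** Inside one block [rho] is injective, so nondegeneracy of [G] kills all non-conjugate pairs. The
    block has just one unordered conjugate pair, over index 0; its coefficient multiplies a nonzero
    product and must vanish as well. *)
Let D_same a a' : e a = e a' -> D a a' = 0.
Proof.
move=> ee; pose b := e a.
pose d al be := \sum_(p : S * S | blockP b p && ((rho p.1, rho p.2) == (al,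
  be))) D p.1 p.2.
have d0 : \sum_a \sum_b d a b *: (G a.1 a.2 * G b.1 b.2) = 0.
  rewrite -[RHS](block0 b) pair_big /= [RHS](partition_big (fun p => (rho p.1,
    rho p.2)) predT) //=.
  apply: eq_bigr => -[x y] _; rewrite /d scaler_suml; apply: eq_bigr => p.
  by rewrite xpair_eqE /= => /andP[_ /andP[/eqP<- /eqP<-]].
have dE x y : e x = b -> e y = b -> d (rho x) (rho y) = D x y.
  move=> ex ey; rewrite /d (bigD1 (x, y)) /blockP /= ?ex ?ey ?eqxx //.
  rewrite big1 ?addr0 // => -[p1 p2] /andP[/andP[/andP[/eqP/= e1 /eqP/= e2] /eqP rr]
    /eqP[]].
  have r1 : rho p1 = rho x := congr1 fst rr; have r2 : rho p2 = rho y := congr1 snd rr.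
  by congr (_, _); apply: rho_inj; rewrite ?e1 ?e2.
have D0 x y : e x = b -> e y = b -> rho y != conj_index (rho x) -> D x y = 0.
  move=> ex ey /(ndG d0); rewrite !dE // DC -mulr2n => /eqP.
  by rewrite mulrn_eq0 => /eqP.
have [ra|] := eqVneq (rho a') (conj_index (rho a)); last by apply: D0.
have a0 := conj_index_e ee ra.
have := block0 b; rewrite (bigD1 (a, a')) /blockP /= -?ee ?eqxx //.
have naa : (a', a) != (a, a').
  apply/eqP => -[aa _]; move: ra; rewrite aa /conj_index; case: (rho a) => i z [].
  by case: z.
rewrite (bigD1 (a', a)) /= -?ee ?eqxx // big1 ?addr0 => [|[p1 p2]].
  rewrite [D a' a]DC [g a' * _]mulrC -scalerDl -mulr2n => /eqP.
  rewrite scaler_eq0 mulrn_eq0 /= => /orP[/eqP//|].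
  have -> : g a' = G 0%N (~~ (rho a).2) by rewrite /g ra /conj_index a0.
  have -> : g a = G 0%N (rho a).2 by rewrite /g a0.
  by case: (rho a).2; rewrite /= ?[G _ false * _]mulrC (negPf f_neq0).
case/andP => /andP[/andP[/= /eqP e1 /eqP e2] /eqP n1] /eqP n2.
have [rp|] := eqVneq (rho p2) (conj_index (rho p1)); last first.
  by move/(D0 _ _ e1 e2) => ->; rewrite scale0r.
(* A second conjugate pair in the block would also lie over index 0 and hence be (a, a') or (a',
   a). *)
have p0 := conj_index_e (etrans e1 (esym e2)) rp; exfalso.
have [r2|r2] := eqVneq (rho p1).2 (rho a).2.
  apply: n1; congr (_, _); apply: rho_inj; rewrite ?e1 ?e2 -?ee //.
    by rewrite [LHS]surjective_pairing [RHS]surjective_pairing p0 a0 r2.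
  by rewrite rp ra /conj_index p0 a0 r2.
have r2' : ~~ (rho p1).2 = (rho a).2 by move: r2; case: (rho p1).2; case: (rho a).2.
apply: n2; congr (_, _); apply: rho_inj; rewrite ?e1 ?e2 -?ee //.
  by rewrite ra /conj_index -r2' negbK a0 -p0 -surjective_pairing.
by rewrite rp /conj_index r2' p0 -a0 -surjective_pairing.
Qed.

Lemma extension_relation a b : b != conj_index a -> (c a b + c b a).[0] = 0.
Proof.
have [ee _|ne nab] := eqVneq (e a) (e b); first exact: D_same.
have neg (x y : bool) : x != y -> y = ~~ x by case: x; case: y.
have eb := neg _ _ ne.
have nr : rho b != conj_index (rho a).
  apply: contraNneq nab => rb; apply/eqP/rho_inj; first by rewrite rb.
  by rewrite eb /e /= addNb.
(* Another member of the fibre with different multipliers must have them interchanged, which is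
   possible only over index 0. There either rho a = rho b and the member is (b, a), or rho a and rho
   b are conjugate, which was excluded. *)
apply: fiber_pick => // -[p1 p2] /= r1 r2 n1 n2.
have [e12|/neg e12] := eqVneq (e p1) (e p2); first exact: D_same.
have [e1|/neg e1] := eqVneq (e p1) (e a).
  by case: n1; congr (_, _); apply: rho_inj; rewrite ?eb ?e12 ?e1.
have p1a : p1 <> a by move=> p1a; move: e1; rewrite p1a; case: (e a).
have p2b : p2 <> b by move=> h; move: eb; rewrite -h e12 e1; case: (e p1).
have a0 : (rho a).1 = ord0 by apply/eqP/contraT => /(rho_pos r1).
have b0 : (rho b).1 = ord0 by apply/eqP/contraT => /(rho_pos r2).
have [r12|/neg r12] := eqVneq (rho a).2 (rho b).2.
  have rab : rho a = rho b by rewrite [LHS]surjective_pairing [RHS]surjective_pairing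
    a0 b0 r12.
  case: n2; congr (_, _); apply: rho_inj; rewrite ?r1 ?r2 ?rab // ?e12 ?eb e1 ?negbK //.
case/eqP: nr; rewrite /conj_index a0 -r12 -b0 -surjective_pairing //.
Qed.

End Extension.

(** * Nonvanishing of the determinant of the extended family *)

Definition index_pair k (x : product_index k.+1) : ('I_k.+1 * bool) * ('I_k.+1 *
  bool) :=
  if x is Some (i, j, b) then signed_pair i j b else ((ord0, true), (ord0, false)).

Lemma index_pairK k (x : product_index k.+1) : pair_index (index_pair x).1
  (index_pair x).2 = x.
Proof. by case: x => [[[i j] b]|] //; rewrite pair_index_signed_pair. Qed.

Lemma product_at_signed_pair (K : idomainType) k (G : nat -> bool ->
  {poly K}) (x : product_index k.+1) :
  G (index_pair x).1.1 (index_pair x).1.2 * G (index_pair x).2.1 (index_pair x).2.2 =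
    product_at G x.
Proof. by case: x => [[[i j] b]|]. Qed.

Lemma sum_product_at (K : idomainType) k (G : nat -> bool ->
  {poly K}) (v : product_index k.+1 -> K) :
  \sum_a \sum_b (\sum_(x | index_pair x == (a, b)) v x) *: (G a.1 a.2 * G b.1 b.2) =
  \sum_x v x *: product_at G x.
Proof.
rewrite pair_big /= [RHS](partition_big (@index_pair k) predT) //=.
apply: eq_bigr => -[a b] _; rewrite scaler_suml; apply: eq_bigr => x /eqP ex.
by rewrite -product_at_signed_pair ex.
Qed.

Lemma sum_index_pair (K : idomainType) k (v : product_index k.+1 ->
  K) (x : product_index k.+1) :
  x != None ->
  let: (a, b) := index_pair x in
  \sum_(y | index_pair y == (a, b)) v y + \sum_(y | index_pair y == (b, a)) v y =
  v x *+ (a == b).+1 /\ b != conj_index a.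
Proof.
case Ex: (index_pair x) => [a b] x0; split; last first.
  case: x x0 Ex => // -[[i j] b'] _ [<- <-]; rewrite /conj_index xpair_eqE /=.
  by apply/negP => /andP[/eqP->]; rewrite ltnn addbF; case: b'.
have inj (y : product_index k.+1) a' b' : index_pair y = (a', b') ->
  y = pair_index a' b' by move=> Ey; rewrite -[y]index_pairK Ey.
rewrite (big_pred1 x); last first.
  by move=> y; apply/eqP/eqP => [/inj ->|->//]; apply/esym/inj.
have [ab|ab] := eqVneq a b.
  subst b; rewrite (big_pred1 x) // => y.
  by apply/eqP/eqP => [/inj ->|->//]; apply/esym/inj.
rewrite big_pred0 ?addr0 // => y; apply/negP => /eqP yE; case/eqP: ab.
have xy : y = x by rewrite (inj _ _ _ yE) pair_indexC; apply/esym/inj.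
by move: yE; rewrite xy Ex => -[].
Qed.

(** A vanishing determinant yields a relation over K[t], which may be taken primitive. At t = 0 its
    coefficients of non-conjugate products vanish by [extension_relation], and then so does the one
    of the common product, which is nonzero; this contradicts primitivity. *)
Lemma extension_det_neq0 (K : numFieldType) k (G : nat -> bool -> {poly K}) :
    pairing k.+1 G -> G 0%N true * G 0%N false != 0 ->
    (forall (i : 'I_k.+1) b, (size (G i b) <= (k.+1 ^ 2).+1)%N) ->
    \det (product_mx k.+1 G) != 0 ->
  exists s : ((2 * k.+1).+1).-tuple K, \det (product_mx k.+2 (extension k G s)) != 0.
Proof.
move=> pG f0 sG dG; have ndG := nondegenerate_det pG dG.
have cm b : (count (fun p => p != 0%R) (mixed_products k G b) <= (2 * k.+1).+1)%N.
  apply: leq_trans (count_size _ _) _.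
  by rewrite !size_cat !size_map size_iota /= addn1 addnS mul2n addnn.
have [s sP] := separating_points (cm true) (cm false); exists s.
have {}sP b p : lincomb (mixed_products k G b) p -> (forall x, x \in s ->
  p.[x] = 0) -> p = 0.
  by move=> /sP; apply; case: b; [left | right].
pose h := \prod_(x <- s) ('X - x%:P); have h0 : h != 0.
  by rewrite prodf_seq_neq0; apply/allP => x _ /=; rewrite polyXsubC_eq0.
have size_perturbed b : (size (perturbed s b) <= (2 * k.+1).+2)%N.
  by rewrite /perturbed size_prod_XsubC size_tuple.
have pred_le m p : (m <= p.+1 -> m.-1 <= p)%N by lia.
(* The degrees add up: (k+1)^2 + 2(k+1) + 1 = (k+2)^2. *)
have sE i b : (size (extension k G s i b) <= (k.+2 ^ 2).+1)%N.
  apply: leq_trans (size_polyMleq _ _) _; rewrite size_map_inj_poly ?polyC0 //;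
    last exact: polyC_inj.
  have := leq_add (_ : (size (G (if (i < k.+1)%N then i else 0%N) b) <= (k.+1 ^
    2).+1)%N) (size_perturbed (b (+) (i == k.+1))).
  case: ltnP => ik; [move/(_ (sG (Ordinal ik) b)) | move/(_ (sG ord0 b))] => le_s;
   by apply: pred_le; apply: leq_trans le_s _; lia.
apply/negP => /eqP/product_mx_kernel[|v []].
  move=> x; rewrite card_product_index -product_at_signed_pair;
    apply: leq_trans (size_polyMleq _ _) _.
  by apply/pred_le/(leq_trans (leq_add (sE _ _) (sE _ _))); lia.
move=> /primitive_relation/[apply] -[{}v [[x0 vx0] vE]].
pose c a b := \sum_(x | index_pair x == (a, b)) v x.
have := extension_relation ndG f0 sP (c := c); rewrite /c sum_product_at => /(_ vE) cP.
have vS x : x != None -> (v x).[0] = 0.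
  move=> /(sum_index_pair v); case Ex: (index_pair x) => [a b] [cE nab].
  by have := cP _ _ nab; rewrite cE hornerMn => /eqP; rewrite mulrn_eq0 => /eqP.
case: x0 vx0 => [x /eqP[]|]; first exact: vS.
have := congr1 (map_poly (horner_eval 0)) vE.
rewrite rmorph_sum rmorph0 (bigD1 None) //= [X in _ + X]big1 => [|x xN]; last first.
  by rewrite map_polyZ /= horner_evalE vS // scale0r.
rewrite addr0 map_polyZ /= => /eqP; rewrite scaler_eq0 => /orP[->//|].
rewrite rmorphM /= mulf_eq0.
suff nz b : map_poly (horner_eval 0) (extension k G s 0 b) != 0 by rewrite !(negPf
  (nz _)).
rewrite rmorphM /= horner0_perturbed -map_poly_comp map_poly_id;
  last by move=> ? _ /=; exact: hornerC.
rewrite mulf_neq0 //; move: f0; rewrite mulf_eq0 negb_or => /andP[].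
by case: b.
Qed.

(** * Choosing the roots *)

(* The i-th factor exchanges the two roots of the pairs in the block
   i^2 <= j < (i+1)^2; all factors agree on the pairs outside these blocks. *)
Definition flipped (i j : nat) : bool := (0 < i)%N && (i ^ 2 <= j < i.+1 ^ 2)%N.

Definition half_product (K : nzRingType) d (l : nat -> bool ->
  K) (i : nat) (b : bool) : {poly K} :=
  \prod_(j < d) ('X - (l j (b (+) flipped i j))%:P).

Lemma map_half_product (K L : nzRingType) (phi : {rmorphism K -> L}) d l i b :
  map_poly phi (half_product d l i b) = half_product d (fun j b => phi (l j b)) i b.
Proof.
rewrite rmorph_prod /=; apply: eq_bigr => j _.
by rewrite rmorphB /= map_polyX map_polyC.
Qed.

Lemma half_product_pair (K : idomainType) d (l : nat -> bool -> K) i :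
  half_product d l i true * half_product d l i false =
  \prod_(j < d) (('X - (l j true)%:P) * ('X - (l j false)%:P)).
Proof.
rewrite -big_split; apply: eq_bigr => j _ /=.
by case: (flipped i j); rewrite //= mulrC.
Qed.

Lemma half_product_pairing (K : idomainType) d (l : nat -> bool ->
  K) n : pairing n (half_product d l).
Proof. by move=> i; rewrite !half_product_pair. Qed.

Lemma half_product_neq0 (K : idomainType) d (l : nat -> bool ->
  K) i b : half_product d l i b != 0.
Proof. by apply/prodf_neq0 => j _; rewrite polyXsubC_eq0. Qed.

Lemma size_half_product (K : idomainType) d (l : nat -> bool -> K) i b :
  size (half_product d l i b) = d.+1.
Proof. by rewrite /half_product size_prod_XsubC /index_enum -enumT size_enum_ord. Qed.

Lemma eq_product_mx (K : idomainType) k (G G' : nat -> bool -> {poly K}) :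
  (forall (i : 'I_k.+1) b, G i b = G' i b) -> product_mx k.+1 G = product_mx k.+1 G'.
Proof. by move=> GG; apply/matrixP => r s;
  rewrite !mxE -!product_at_signed_pair !GG. Qed.

Lemma map_product_mx (K L : idomainType) (phi : {rmorphism K -> L}) k (G : nat ->
  bool -> {poly K}) :
  map_mx phi (product_mx k.+1 G) = product_mx k.+1 (fun i b => map_poly phi (G i b)).
Proof.
by apply/matrixP => r s; rewrite !mxE -coef_map -!product_at_signed_pair rmorphM.
Qed.

Lemma half_product_det_base (K : numFieldType) :
  \det (product_mx 1 (half_product 1 (fun _ b => b%:R : K))) != 0.
Proof.
set l := fun _ b => _; set G := half_product 1 l.
have GE (i : 'I_1) b : G i b = 'X - b%:R%:P.
  by rewrite (ord1 i) /G /half_product big_ord1 /l (_ : flipped _ _ = false) ?addbF //.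
apply/negP => /eqP/product_mx_kernel[|v [[x vx] vE]].
  move=> x; rewrite card_product_index -product_at_signed_pair;
    apply: leq_trans (size_polyMleq _ _) _.
  by rewrite !size_half_product.
have GE0 b : G 0%N b = 'X - b%:R%:P by rewrite -(GE ord0).
have vS (b : bool) : v (Some (ord0, ord0, b)) = 0.
  (* At the root of [G 0 (~~ b)] only the square of [G 0 b] survives. *)
  have /(congr1 (fun p => p.[(~~ b)%:R])) := vE.
  rewrite horner0 horner_sum (bigD1 (Some (ord0, ord0, b))) //= big1 ?addr0.
    rewrite hornerZ hornerM ltnn addbF GE0 hornerXsubC => /eqP.
    by case: b; rewrite !mulf_eq0 /= ?subr0 ?sub0r ?oppr_eq0 !oner_eq0 !orbF => /eqP.
  case=> [[[i j] b']|_]; last first.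
    by rewrite hornerZ hornerM !GE0 !hornerXsubC; case: (b);
      rewrite /= subrr ?(mul0r, mulr0).
  rewrite (ord1 i) (ord1 j) => nb; have -> : b' = ~~ b by case: b b' nb => [] [].
  by rewrite hornerZ hornerM ltnn addbF GE0 hornerXsubC subrr !mulr0.
have vN : v None = 0.
  have := vE; rewrite (bigD1 None) //= big1 ?addr0.
    by move/eqP; rewrite scaler_eq0 mulf_eq0 !(negPf (half_product_neq0 _ _ _ _))
      !orbF => /eqP.
  by case=> [[[i j] b']|//] _; rewrite (ord1 i) (ord1 j) vS scale0r.
by move: vx; case: x => [[[i j] b]|]; rewrite ?vN ?(ord1 i) ?(ord1 j) ?vS eqxx.
Qed.

Lemma exists_half_product_square (K : numFieldType) k :
  exists l : nat -> bool -> K, \det (product_mx k.+1 (half_product (k.+1 ^ 2) l)) != 0.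
Proof.
elim: k => [|k [l dl]]; first by exists (fun _ b => b%:R); exact: half_product_det_base.
have [||i b|//|s ds] := @extension_det_neq0 _ k (half_product (k.+1 ^ 2) l).
- exact: half_product_pairing.
- by rewrite mulf_neq0 ?half_product_neq0.
- by rewrite size_half_product.
(* The determinant is a nonzero polynomial in t, so t can be specialised. The new root pairs are put
   in the positions from (k+1)^2 on, which is the block flipped by the index k + 1. *)
have [t] := poly_nonroot ds.
rewrite -horner_evalE -det_map_mx map_product_mx => dt.
exists (fun j b =>
  if (j < k.+1 ^ 2)%N then l j b else s`_(j - k.+1 ^ 2) + (if b then t else 0)).
set l' := fun j b => _; apply: etrans dt; congr (\det _ != 0);
  apply: eq_product_mx => i b.
apply: esym.
have -> : (k.+2 ^ 2 = k.+1 ^ 2 + (2 * k.+1).+1)%N by lia.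
rewrite /half_product big_split_ord /= rmorphM /= -map_poly_comp map_poly_id;
  last by move=> ? _ /=; exact: hornerC.
congr (_ * _).
  apply: eq_bigr => j _; rewrite /l' ltn_ord; congr ('X - (l _ (_ (+) _))%:P).
  (* On the old positions the index k + 1 flips nothing and so agrees with the index 0, as
     [extension] demands. *)
  have := ltn_ord i; rewrite ltnS leq_eqVlt => /orP[/eqP->|->//].
  by rewrite ltnn /flipped /= [(_ <= j)%N]leqNgt ltn_ord.
rewrite /perturbed big_tuple rmorph_prod; apply: eq_bigr => j _ /=.
rewrite rmorphB /= map_polyX map_polyC /=; congr ('X - _%:P).
rewrite horner_evalE hornerD hornerC /l' ltnNge leq_addr addKn (tnth_nth 0);
  congr (_ + _).
have -> : flipped i (k.+1 ^ 2 + j) = (i == k.+1 :> nat).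
  rewrite /flipped; have := ltn_ord j; have := ltn_ord i;
    rewrite ltnS leq_eqVlt => /orP[/eqP-> hj|hi _].
    by rewrite eqxx leq_addr /=; lia.
  rewrite (ltn_eqF hi); apply/negP => /andP[_ /andP[_ h]].
  have : (i.+1 ^ 2 <= k.+1 ^ 2)%N by rewrite leq_exp2r.
  by lia.
by case: (b (+) _); rewrite ?hornerX ?horner0.
Qed.

(** The additional pairs consist of two equal roots, so all products are multiplied by the same h^2.
    The matrix sees only the lowest N coefficients, so the common roots must differ from 0: h is
    then prime to X, and X^N divides a combination p of the old products, whose size is at most
    N. *)
Lemma exists_half_product (K : numFieldType) k d : (k.+1 ^ 2 <= d)%N ->
  exists l : nat -> bool -> K, \det (product_mx k.+1 (half_product d l)) != 0.
Proof.
move=> kd; have [l dl] := exists_half_product_square K k.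
pose l' j b := if (j < k.+1 ^ 2)%N then l j b else 1.
exists l'; pose h : {poly K} := ('X - 1%:P) ^+ (d - k.+1 ^ 2).
have famE (i : 'I_k.+1) b : half_product d l' i b = half_product (k.+1 ^ 2) l i b * h.
  rewrite -{1}(subnKC kd) /half_product big_split_ord /=; congr (_ * _).
    by apply: eq_bigr => j _; rewrite /l' ltn_ord.
  rewrite /h -[X in _ ^+ X]card_ord -prodr_const.
  by apply: eq_bigr => j _; rewrite /l' ltnNge leq_addr.
have pE (x : product_index k.+1) : product_at (half_product d l') x = product_at
  (half_product (k.+1 ^ 2) l) x * (h * h).
  by rewrite -!product_at_signed_pair !famE mulrACA.
apply: contraNneq dl => /eqP/det0P[v v0 vA]; apply/det0P; exists v => //.
set N := #|product_index k.+1| in v v0 vA *.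
pose p := \sum_r v 0 r *: product_at (half_product (k.+1 ^ 2) l) (enum_val r).
have ps : (size p <= N)%N.
  apply: (leq_trans (size_sum _ _ _)); apply/bigmax_leqP => r _.
  apply: leq_trans (size_scale_leq _ _) _; rewrite -product_at_signed_pair.
  apply: leq_trans (size_polyMleq _ _) _;
    rewrite !size_half_product /N card_product_index; lia.
have dv : 'X^N %| p * (h * h).
  apply/dvdpP; exists (drop_poly N (p * (h * h))).
  rewrite -[LHS](poly_take_drop N) [take_poly _ _](_ : _ = 0) ?add0r //.
  apply/polyP => j; rewrite coef_take_poly coef0; case: ltnP => // jN.
  have /rowP/(_ (Ordinal jN)) := vA; rewrite !mxE => vj; apply: etrans vj.
  rewrite mulr_suml coef_sum; apply: eq_bigr => r _.
  by rewrite !mxE pE -scalerAl coefZ.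
have p0 : p = 0.
  move: dv; rewrite Gauss_dvdpl; last first.
    by rewrite coprimepMr !coprimep_expr // coprimep_XsubC rootE hornerXn expr1n
      oner_eq0.
  by move=> /dvdp_leq; case: eqVneq => // p0 /(_ isT); rewrite size_polyXn ltnNge ps.
apply/rowP => j; rewrite !mxE -[RHS](coef0 K j) -p0 coef_sum; apply: eq_bigr => r _.
by rewrite !mxE coefZ.
Qed.

(** * From the roots to the coefficients *)

Lemma rmorph_mmap n (A : nzRingType) (B C : nzRingType) (phi : {rmorphism B -> C})
    (f : A -> B) (h : 'I_n -> B) p :
  phi (mmap f h p) = mmap (phi \o f) (phi \o h) p.
Proof.
rewrite /mmap rmorph_sum; apply: eq_bigr => m _; rewrite rmorphM /mmap1 rmorph_prod.
by congr (_ * _); apply: eq_bigr => i _; rewrite rmorphXn.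
Qed.

Lemma eq_mmap n (A B : nzRingType) (f f' : A -> B) (h h' : 'I_n -> B) p :
  f =1 f' -> h =1 h' -> mmap f h p = mmap f' h' p.
Proof.
move=> ff hh; rewrite /mmap; apply: eq_bigr => m _; rewrite ff /mmap1.
by congr (_ * _); apply: eq_bigr => i _; rewrite hh.
Qed.

Lemma mmap_comp n m (A : comNzRingType) (B : comNzRingType) (phi : {rmorphism A -> B})
    (h : 'I_m -> B) (t : {mpoly A[n]}) (q : n.-tuple {mpoly A[m]}) :
  mmap phi h (t \mPo q) = mmap phi (fun i => mmap phi h (tnth q i)) t.
Proof.
rewrite /comp_mpoly (rmorph_mmap (mmap phi h)).
by apply: eq_mmap => // a /=; rewrite mmapC.
Qed.

Lemma mmap_mesym n k (A B : comNzRingType) (phi : {rmorphism A -> B}) (h : 'I_n -> B) :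
  mmap phi h (mesym n A k) = (mesym n B k).@[h].
Proof.
rewrite /mesym !rmorph_sum; apply: eq_bigr => X _; rewrite !rmorph_prod.
by apply: eq_bigr => i _ /=; rewrite mmapX mmap1U mevalXU.
Qed.

Lemma msym_prod_symmetric n (A : comNzRingType) (D : {mpoly A[n]}) :
  \prod_(s : 'S_n) msym s D \is symmetric.
Proof.
apply/issymP => s; rewrite rmorph_prod [RHS](reindex_inj (mulIg s)).
by apply: eq_bigr => t _; rewrite msymMm.
Qed.

Lemma coef_comp_scale (A : comNzRingType) (p : {poly A}) a j :
  (p \Po (a *: 'X))`_j = a ^+ j * p`_j.
Proof.
rewrite comp_polyE coef_sum.
under eq_bigr => i _ do rewrite exprZn scalerA coefZ coefXn.
have [jp|jp] := ltnP j (size p).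
  rewrite (bigD1 (Ordinal jp)) //= eqxx mulr1 mulrC big1 ?addr0 // => i.
  by rewrite -val_eqE eq_sym /= => /negPf ->; rewrite mulr0.
rewrite [p`_j]nth_default // mulr0 big1 // => i _.
by rewrite gtn_eqF ?mulr0 // (leq_trans (ltn_ord i)).
Qed.

Lemma prod_XsubC_scale (A : fieldType) m (r : 'I_m -> A) a :
  (\prod_i ('X - (a * r i)%:P)) \Po (a *: 'X) = a ^+ m *: \prod_i ('X - (r i)%:P).
Proof.
rewrite rmorph_prod /= -[X in a ^+ X]card_ord -prodr_const -scaler_prod.
by apply: eq_bigr => i _;
  rewrite comp_polyB comp_polyX comp_polyC polyCM mul_polyC scalerBr.
Qed.

(* The elementary symmetric functions of the roots multiplied by the leading
   coefficient are polynomials in the coefficients, whence the scaled roots. *)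
Lemma generic_roots (R : fieldType) m (D : {mpoly R[m]}) : D != 0 ->
  exists Q : {mpoly R[m.+1]}, (1 < msize Q)%N /\
    forall c : 'I_m.+1 -> R, Q.@[c] != 0 -> c ord_max != 0 /\
    forall (L : fieldType) (phi : {rmorphism R -> L}) (r : 'I_m -> L),
      \sum_i phi (c i) *: 'X^i = phi (c ord_max) *: \prod_i ('X - (r i)%:P) ->
    mmap phi (fun i => phi (c ord_max) * r i) D != 0.
Proof.
(* The product of all conjugates of [D] is symmetric and has [D] itself as a factor. *)
move=> D0; pose N := \prod_(s : 'S_m) msym s D.
have N0 : N != 0.
  apply/prodf_neq0 => s _; apply: contraNneq D0 => sD.
  by rewrite -[D]msym1m -(mulgV s) msymMm sD msym0.
have [t [tN _]] := sym_fundamental (msym_prod_symmetric D); rewrite -/N in tN.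
(* By Vieta, the elementary symmetric function of degree i + 1 in the roots scaled by the leading
   coefficient c_m is (-1)^(i+1) c_m^i c_(m-i-1). *)
pose q := [tuple (-1) ^+ i.+1 *: ('X_(ord_max : 'I_m.+1) ^+ i * 'X_(inord (m -
  i.+1))) : {mpoly R[m.+1]} | i < m].
pose Q := 'X_(ord_max : 'I_m.+1) * (t \mPo q); exists Q; split.
  (* Substituting the coefficients of the monic polynomial with indeterminate roots turns Q into N,
     so Q is nonzero. It is not constant either, since its factor c_m makes it vanish at 0. *)
  pose w (i : 'I_m.+1) : {mpoly R[m]} := (-1) ^+ (m - i) * mesym m R (m - i).
  have wQ : mmap (@mpolyC m R) w Q = N.
    rewrite rmorphM /= mmapX mmap1U /w subnn mesym0E mul1r mul1r.
    rewrite -tN /comp_mpoly (rmorph_mmap (mmap (@mpolyC m R) w)).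
    apply: eq_mmap => [x|i] /=; first by rewrite mmapC.
    rewrite !tnth_mktuple mmapZ rmorphM rmorphXn /= !mmapX !mmap1U /w subnn mesym0E.
    rewrite inordK ?ltnS ?leq_subr // subKn // expr0 mul1r expr1n mul1r.
    by rewrite rmorphXn rmorphN rmorph1 mulrA -exprD addnn -signr_odd odd_double mul1r.
  rewrite ltnNge; apply/negP => /msize1_polyC QC.
  have Q0 : Q = 0.
    rewrite QC; apply/eqP; rewrite mpolyC_eq0; apply/eqP.
    by rewrite -[LHS](mevalC (fun _ : 'I_m.+1 => 0 : R) Q@_0) -QC mevalM mevalXU mul0r.
  by move/eqP: N0; apply; rewrite -wQ Q0 rmorph0.
move=> c; rewrite mevalM mevalXU mulf_eq0 negb_or => /andP[c0 tc0];
  split=> // L phi r cr.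
set a := phi (c ord_max) in cr *; have a0 : a != 0 by rewrite fmorph_eq0.
set h := fun i => a * r i.
suff : mmap phi h N != 0.
  rewrite rmorph_prod => /prodf_neq0/(_ 1%g isT); by rewrite msym1m.
rewrite -tN mmap_comp; move: tc0;
  rewrite comp_mpoly_meval -(fmorph_eq0 phi) /meval rmorph_mmap.
apply: contra_neq => tc0; apply: etrans tc0; apply: eq_mmap => // i.
rewrite !tnth_mktuple mmap_mesym /=.
have := mroots_coeff [tuple h i | i < m] (inord i.+1).
rewrite inordK ?ltnS // big_tuple; under eq_bigr do rewrite tnth_mktuple.
under meval_eq do rewrite tnth_mktuple; move=> vie.
have vie2 : (\prod_i ('X - (h i)%:P))`_(m - i.+1) = a ^+ i * phi (c (inord (m - i.+1))).
  apply: (mulfI (expf_neq0 (m - i.+1) a0)).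
  rewrite -coef_comp_scale prod_XsubC_scale coefZ mulrA -exprD addnC.
  have -> : (a ^+ m = a ^+ (i + (m - i.+1)) * a).
    by rewrite -exprSr; congr (_ ^+ _); have := ltn_ord i; lia.
  rewrite -mulrA -coefZ -cr coef_sum (bigD1 (inord (m - i.+1))) //= big1 ?addr0 => [|j].
    by rewrite coefZ coefXn inordK ?ltnS ?leq_subr // eqxx mulr1.
  rewrite -val_eqE /= inordK ?ltnS ?leq_subr // => /negPf jn.
  by rewrite coefZ coefXn eq_sym jn mulr0.
rewrite vie2 in vie.
rewrite /q tnth_mktuple -/(meval _ _) mevalZ mevalM rmorphXn /= !mevalXU !rmorphM
  !rmorphXn -/a vie.
by rewrite rmorphN rmorph1 mulrA -exprD addnn -signr_odd odd_double mul1r.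
Qed.

(** * Nonnegative real polynomials *)

Lemma poly_ge0_closure (R : rcfType) (p : {poly R}) r :
  (forall e, 0 < e -> exists y, `|y - r| < e /\ 0 <= p.[y]) -> 0 <= p.[r].
Proof.
move=> h; rewrite leNgt; apply/negP => pr; have pr' : 0 < - p.[r] by rewrite oppr_gt0.
have [e e0 he] := poly_cont r p pr'; have [y [ye py]] := h e e0.
have := he y ye; rewrite ltNge => /negP; apply.
by rewrite (le_trans _ (ler_norm _)) // lerDr.
Qed.

(** The cofactor of X - r is nonnegative to the right of r and nonpositive to the left, so by
    continuity it vanishes at r. Continuity also gives the sign of the second cofactor at r. *)
Lemma nonneg_double_root (R : rcfType) (p : {poly R}) r :
  (forall x, 0 <= p.[x]) -> root p r ->
  exists q, p = ('X - r%:P) ^+ 2 * q /\ forall x, 0 <= q.[x].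
Proof.
move=> p0 /factor_theorem[q pq].
have q_gt x : r < x -> 0 <= q.[x].
  by move=> rx; have := p0 x; rewrite pq hornerM hornerXsubC pmulr_lge0 ?subr_gt0.
have q_lt x : x < r -> 0 <= (- q).[x].
  move=> rx; have := p0 x; rewrite pq hornerM hornerXsubC hornerN oppr_ge0.
  by rewrite nmulr_lge0 ?subr_lt0.
have qr : q.[r] = 0.
  apply/le_anti/andP; split.
    rewrite -oppr_ge0 -hornerN; apply: poly_ge0_closure => e e0.
    exists (r - e / 2); rewrite addrAC subrr sub0r normrN gtr0_norm ?divr_gt0 //.
    split; last by apply: q_lt; rewrite ltrBlDr ltrDl divr_gt0.
    by rewrite ltr_pdivrMr // ltr_pMr // ltr1n.
  apply: poly_ge0_closure => e e0.
  exists (r + e / 2); rewrite addrAC subrr add0r gtr0_norm ?divr_gt0 //.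
  split; last by apply: q_gt; rewrite ltrDl divr_gt0.
  by rewrite ltr_pdivrMr // ltr_pMr // ltr1n.
have /factor_theorem[q' qE] : root q r by rewrite rootE qr.
exists q'; split; first by rewrite pq qE -mulrA -expr2 mulrC.
have q'N x : x != r -> 0 <= q'.[x].
  move=> xr; have := p0 x; rewrite pq qE !hornerM !hornerXsubC -mulrA -expr2.
  by rewrite pmulr_lge0 ?exprn_even_gt0 //= ?subr_eq0.
move=> x; have [->|/q'N//] := eqVneq x r.
apply: poly_ge0_closure => e e0; exists (r + e / 2).
rewrite addrAC subrr add0r gtr0_norm ?divr_gt0 //; split.
  by rewrite ltr_pdivrMr // ltr_pMr // ltr1n.
by apply: q'N; rewrite -subr_eq0 addrAC subrr add0r gt_eqF // divr_gt0.
Qed.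

(** A real root is a double root. A non-real z comes with its conjugate, and the real quadratic with
    these two roots is positive everywhere, so dividing by it preserves nonnegativity. *)
Lemma nonneg_conj_root (R : rcfType) (p : {poly R}) (z : R[i]) :
    (forall x, 0 <= p.[x]) -> root (map_poly (real_complex R) p) z ->
  exists q, [/\ forall x, 0 <= q.[x], (size q = (size p).-2)%N &
    map_poly (real_complex R) p =
      ('X - z%:P) * ('X - (z^*)%C%:P) * map_poly (real_complex R) q].
Proof.
move=> p0 rz.
pose C := map_poly (real_complex R); rewrite -/(C p) in rz *.
have sC q : size (C q) = size q by apply: size_map_poly.
suff [q [q0 pE]] : exists q, (forall x, 0 <= q.[x]) /\
    C p = ('X - z%:P) * ('X - (z^*)%C%:P) * C q.
  exists q; split=> //; rewrite -(sC q) -(sC p) pE.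
  have [->|qn] := eqVneq (C q) 0; first by rewrite mulr0 size_poly0.
  by rewrite !size_monicM ?monicMl ?monicXsubC ?polyXsubC_eq0 // !size_XsubC.
have [zr|zi] := eqVneq (complex.Im z) 0.
  have [r zE] : exists r, z = r%:C%C by exists (complex.Re z);
    rewrite [LHS]complexE zr mulr0 addr0.
  have rr : root p r by move: rz; rewrite zE /C rootE horner_map fmorph_eq0.
  have [q [pE q0]] := nonneg_double_root p0 rr; exists q; split=> //.
  by rewrite pE /C zE conjc_real rmorphM rmorphXn rmorphB /= map_polyX map_polyC expr2.
pose u := 'X ^+ 2 - (2 * complex.Re z) *: 'X + (complex.Re z ^+ 2 + complex.Im z ^+
  2)%:P : {poly R}.
have uE : C u = ('X - z%:P) * ('X - (z^*)%C%:P).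
  have -> : C u = 'X^2 - (2 * complex.Re z)%:C%C *: 'X + (complex.Re z ^+ 2 +
    complex.Im z ^+ 2)%:C%C%:P.
    by rewrite /C rmorphD rmorphB /= map_polyXn map_polyZ map_polyX map_polyC.
  have -> : (2 * complex.Re z)%:C%C = z + (z^*)%C by rewrite addcJ rmorphM rmorph_nat.
  have -> : (complex.Re z ^+ 2 + complex.Im z ^+ 2)%:C%C = z * (z^*)%C.
    case: (z) => x y; simpc; apply/eqP; rewrite eq_complex /=; apply/andP; split;
      apply/eqP; first by ring.
    by rewrite mulrC addNr.
  by rewrite -mul_polyC polyCD polyCM; ring.
have u_gt0 x : 0 < u.[x].
  have -> : u.[x] = (x - complex.Re z) ^+ 2 + complex.Im z ^+ 2 by rewrite /u
    !(hornerD, hornerN, hornerC, hornerZ, hornerXn, hornerX); ring.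
  by rewrite ltr_wpDl ?sqr_ge0 // exprn_even_gt0.
have : C u %| C p.
  rewrite uE Gauss_dvdp; last first.
    rewrite coprimep_XsubC root_XsubC; case: (z) zi => x y /= y0.
    by rewrite eq_complex /= eqxx eqNr.
  rewrite !dvdp_XsubCl rz /= -complex_root_conj -map_poly_comp.
  by rewrite (eq_map_poly (g := real_complex R)) // => x; exact: conjc_real.
rewrite dvdp_map => /dvdpP[q pE]; exists q; split;
  last by rewrite pE /C rmorphM /= -/C uE mulrC.
by move=> x; have := p0 x; rewrite pE hornerM pmulr_lge0.
Qed.

Lemma nonneg_factorization (R : rcfType) d (p : {poly R}) :
    (size p = (2 * d).+1)%N -> (forall x, 0 <= p.[x]) ->
  exists z : nat -> R[i], exists a : R, map_poly (real_complex R) p =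
    a%:C%C *: \prod_(j < d) (('X - (z j)%:P) * ('X - ((z j)^*)%C%:P)).
Proof.
elim: d p => [|d IHd] p sp p0.
  exists (fun=> 0); exists p`_0; rewrite big_ord0 alg_polyC -map_polyC.
  by rewrite [in LHS](size1_polyC (eq_leq sp)).
have [z rz] : exists z, root (map_poly (real_complex R) p) z.
  by apply/closed_rootP; rewrite size_map_poly sp.
have [q [q0 sq pE]] := nonneg_conj_root p0 rz.
have [|w [a qE]] := IHd q _ q0; first by rewrite sq sp; lia.
exists (fun j => if (j < d)%N then w j else z), a.
rewrite pE qE big_ord_recr /= ltnn -scalerAr mulrC; congr (_ *: (_ * _)).
by apply: eq_bigr => j _; rewrite ltn_ord.
Qed.

(** * Nondegenerate factorizations of generic nonnegative polynomials *)

Lemma half_product_scale (K : fieldType) d (l : nat -> bool -> K) a i b :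
  half_product d (fun j b => a * l j b) i b \Po (a *: 'X) = a ^+ d *: half_product d
    l i b.
Proof. exact: prod_XsubC_scale. Qed.

(** [generic_roots] controls the roots only after scaling by the leading coefficient; the
    substitution of aX for X removes that scaling. *)
Lemma nondegenerate_scale (K : fieldType) k d (l : nat -> bool -> K) a : a != 0 ->
  nondegenerate k.+1 (half_product d (fun j b => a * l j b)) ->
    nondegenerate k.+1 (half_product d l).
Proof.
move=> a0 nd c c0; apply: nd; apply/polyP => j.
apply: (mulfI (expf_neq0 j a0)); rewrite -coef_comp_scale coef0 mulr0.
have /(congr1 (fun p : {poly K} => (a ^+ d * a ^+ d) * p`_j)) := c0.
rewrite coef0 mulr0 => c0j; apply: etrans c0j; rewrite -coefZ;
  congr (nth 0 (polyseq _) j).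
rewrite scaler_sumr linear_sum; apply: eq_bigr => x _.
rewrite scaler_sumr linear_sum; apply: eq_bigr => y _ /=.
rewrite comp_polyZ comp_polyM !half_product_scale -scalerAl -scalerAr !scalerA;
  congr (_ *: _).
by ring.
Qed.

Lemma eq_half_product (K : nzRingType) d (l l' : nat -> bool -> K) i b :
  (forall j, (j < d)%N -> l j =1 l' j) -> half_product d l i b = half_product d l' i b.
Proof. by move=> ll; apply: eq_bigr => j _; rewrite ll. Qed.

Lemma prod_pairs (A : comNzRingType) d (F : nat -> bool -> A) :
  \prod_(j < d) (F j true * F j false) = \prod_(i < 2 * d) F i./2 (odd i).
Proof.
elim: d => [|d IHd]; first by rewrite !big_ord0.
rewrite big_ord_recr IHd mulnS !big_ord_recr /= mul2n odd_double uphalf_double.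
by rewrite doubleK -!mulrA; congr (_ * _); rewrite mulrC.
Qed.

(** The determinant with indeterminate roots is a nonzero polynomial, as some specialisation of it
    is nonzero. [generic_roots] turns this into a condition on the coefficients of p, under which
    the actual conjugate root pairs are nondegenerate. *)
Lemma generic_factorization (R : rcfType) k d : (k.+1 ^ 2 <= d)%N ->
  exists Q : {mpoly R[(2 * d).+1]}, (1 < msize Q)%N /\
    forall p : {poly R}, (size p <= (2 * d).+1)%N -> (forall x, 0 <= p.[x]) ->
      Q.@[fun i => p`_i] != 0 ->
    exists (a : R) (l : nat -> bool -> R[i]),
      [/\ 0 < a, forall j b, l j (~~ b) = ((l j b)^*)%C,
          nondegenerate k.+1 (half_product d l) &
          map_poly (real_complex R) p = a%:C%C *: (half_product d l 0 true *
            half_product d l 0 false)].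
Proof.
move=> kd; have [l0 dl0] := @exists_half_product R k d kd.
(* The pair j owns the variables 2j and 2j + 1; the default 0 is not reached for j < d. *)
pose X (j : nat) (b : bool) : {mpoly R[2 * d]} :=
  if insub (2 * j + b)%N is Some i then 'X_i else 0.
pose D := \det (product_mx k.+1 (half_product d X)).
have DE (L : fieldType) (phi : {rmorphism R -> L}) (l : nat -> bool -> L) :
    mmap phi (fun i : 'I_(2 * d) => l i./2 (odd i)) D = \det (product_mx k.+1
      (half_product d l)).
  rewrite -det_map_mx map_product_mx; congr (\det _); apply: eq_product_mx => i b.
  rewrite map_half_product; apply: eq_half_product => j jd b' /=; rewrite /X.
  case: insubP => [u _ uE|]; last by rewrite -leqNgt; case: (b'); lia.
  rewrite mmapX mmap1U uE; congr (l _ _); first by case: (b'); lia.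
  by rewrite oddD mul2n odd_double; case: (b').
have D0 : D != 0.
  by apply: contraNneq dl0 => D0; rewrite -(DE _ idfun) D0 rmorph0.
have [Q [sQ QP]] := generic_roots D0; exists Q; split=> // p sp p0 Qp.
have pE : \sum_(i < (2 * d).+1) (real_complex R p`_i) *: 'X^i = map_poly
  (real_complex R) p.
  rewrite -(poly_def _ (fun i => real_complex R p`_i)); apply/polyP => j;
    rewrite coef_poly coef_map.
  by case: ltnP => // jd; rewrite [p`_j]nth_default ?(leq_trans sp) // rmorph0.
have [/= pd {}QP] := QP _ Qp.
have sp' : size p = (2 * d).+1.
  by apply/eqP; rewrite eqn_leq sp ltnNge; apply: contra pd => ?; rewrite nth_default.
have [z [a zE]] := nonneg_factorization sp' p0.
pose l j (b : bool) := if b then z j else ((z j)^*)%C; exists a, l.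
have lE : half_product d l 0 true * half_product d l 0 false =
    \prod_(j < d) (('X - (z j)%:P) * ('X - ((z j)^*)%C%:P)) by rewrite
      half_product_pair.
have aE : a = p`_(2 * d).
  have mP : \prod_(j < d) (('X - (z j)%:P) * ('X - ((z j)^*)%C%:P)) \is monic.
    by apply: monic_prod => j _; rewrite monicMl monicXsubC.
  have := congr1 lead_coef zE; rewrite lead_coef_map lead_coefZ (monicP mP) mulr1.
  by move=> /complexI <-; rewrite /lead_coef sp'.
have a0 : a != 0 by rewrite aE.
split; last by rewrite lE.
- have [x px] : exists x, p.[x] != 0 by apply: poly_nonroot; rewrite -size_poly_eq0 sp'.
  have {}px : 0 < p.[x] by rewrite lt_def px p0.
  have /(congr1 (fun q => q.[x%:C%C])) := zE;
    rewrite horner_map hornerZ horner_prod => E.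
  have P0 : 0 <= \prod_(j < d) (('X - (z j)%:P) * ('X - ((z j)^*)%C%:P)).[x%:C%C].
    apply: prodr_ge0 => j _; rewrite hornerM !hornerXsubC.
    by rewrite (_ : x%:C%C - (z j)^*%C = ((x%:C - z j)^*)%C) ?mulcJ_ge0 // rmorphB;
      congr (_ - _); apply/esym/conjc_real.
  have : 0 < p.[x]%:C%C by rewrite ltcR.
  rewrite E; move: P0; rewrite le_eqVlt => /orP[/eqP <-|P0];
    first by rewrite mulr0 ltxx.
  by rewrite pmulr_lgt0 // ltcR.
- by move=> j [] /=; rewrite ?conjcK.
have ac : a%:C%C != 0 by rewrite fmorph_eq0.
apply: (nondegenerate_scale ac); apply: nondegenerate_det;
  first exact: half_product_pairing.
rewrite -(DE _ (real_complex R)) aE; apply: QP.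
rewrite pE zE -aE; congr (_ *: _).
by rewrite (prod_pairs d (fun j b => 'X - (l j b)%:P)).
Qed.

(** * The simplex *)

(* The map mu, dehomogenized at y = 1. *)
Definition mu_poly (A : nzRingType) n (x : 'M[A]_n) : {poly A} :=
  \sum_i \sum_j x i j *: 'X^(i + j).

Lemma mu_poly_is_linear (A : nzRingType) n : linear (@mu_poly A n).
Proof.
move=> a x y; rewrite /mu_poly scaler_sumr -big_split; apply: eq_bigr => i _ /=.
rewrite scaler_sumr -big_split; apply: eq_bigr => j _ /=.
by rewrite !mxE scalerDl scalerA.
Qed.

HB.instance Definition _ (A : nzRingType) n :=
  GRing.isLinear.Build A 'M[A]_n {poly A} _ (@mu_poly A n) (@mu_poly_is_linear A n).

Lemma rVpolyE (A : nzRingType) n (u : 'rV[A]_n) : rVpoly u = \sum_i u 0 i *: 'X^i.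
Proof.
rewrite /rVpoly poly_def; apply: eq_bigr => i _.
by rewrite insubT // => ? ; congr (u _ _ *: _); apply/val_inj.
Qed.

Lemma mu_poly_tensor (A : comNzRingType) n (u v : 'rV[A]_n) :
  mu_poly (u^T *m v) = rVpoly u * rVpoly v.
Proof.
rewrite !rVpolyE mulr_suml; apply: eq_bigr => i _.
rewrite mulr_sumr; apply: eq_bigr => j _.
by rewrite mxE big_ord1 mxE -scalerAl -scalerAr scalerA exprD.
Qed.

Lemma map_mu_poly (A B : nzRingType) (phi : {rmorphism A -> B}) n (x : 'M[A]_n) :
  map_poly phi (mu_poly x) = mu_poly (map_mx phi x).
Proof.
rewrite /mu_poly rmorph_sum; apply: eq_bigr => i _; rewrite rmorph_sum.
by apply: eq_bigr => j _ /=; rewrite map_polyZ map_polyXn mxE.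
Qed.

Lemma size_mu_poly (A : nzRingType) d (x : 'M[A]_d.+1) : (size (mu_poly x) <= (2 *
  d).+1)%N.
Proof.
apply: (leq_trans (size_sum _ _ _)); apply/bigmax_leqP => i _.
apply: (leq_trans (size_sum _ _ _)); apply/bigmax_leqP => j _.
apply: leq_trans (size_scale_leq _ _) _; rewrite size_polyXn.
by have := ltn_ord i; have := ltn_ord j; lia.
Qed.

Lemma fpolyK (R : realType) m : cancel (@fpoly R m) (@fcoef R m).
Proof.
move=> y; apply/rowP => i; rewrite mxE /= raddf_sum (bigD1 i) //= big1 => [|j ji].
  by rewrite mcoeffZ mcoeffX eqxx mulr1 addr0.
rewrite mcoeffZ mcoeffX; case: eqP => [/mnmP/(_ ord0)|]; last by rewrite mulr0.
by rewrite !mnmE eqxx => /val_inj e; rewrite e eqxx in ji.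
Qed.

Lemma mu_mu_poly (R : realType) d (x : 'M[R]_d.+1) (f : bform R (2 * d)) :
  (mu x = f) <-> mu_poly x = rVpoly (fcoef f).
Proof.
have muE : mu x = fpoly (poly_rV (mu_poly x) : 'rV_(2 * d).+1).
  have key i : (i <= 2 * d)%N ->
      \sum_(s < (2 * d).+1) ('X^i : {poly R})`_s *: 'X_[bmon (2 * d) s] = 'X_[bmon (2
        * d) i].
    move=> id; rewrite (bigD1 (inord i)) //= inordK // coefXn eqxx scale1r big1
      ?addr0 // => s.
    by rewrite -val_eqE /= inordK // coefXn => /negPf ->; rewrite scale0r.
  rewrite /= /mu; under [RHS]eq_bigr do rewrite mxE /mu_poly coef_sum scaler_suml.
  rewrite [RHS]exchange_big; apply: eq_bigr => i _.
  under [RHS]eq_bigr do rewrite coef_sum scaler_suml.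
  rewrite [RHS]exchange_big; apply: eq_bigr => j _ /=.
  under [RHS]eq_bigr do rewrite coefZ -scalerA.
  have ij : (i + j <= 2 * d)%N by have := ltn_ord i; have := ltn_ord j; lia.
  rewrite -scaler_sumr key // -mpolyXD; congr (_ *: 'X_[_]); apply/mnmP => s.
  rewrite mnmDE !mnmE; case: eqP => // _.
  by have := ltn_ord i; have := ltn_ord j; lia.
rewrite muE; split => [|xf]; last by rewrite xf rVpolyK fcoefK.
move=> /val_inj/(congr1 (@fcoef R (2 * d))) <-; rewrite fpolyK poly_rV_K //.
exact: size_mu_poly.
Qed.

(** * Kernels of convex combinations of Gram matrices *)

Lemma psd_gram (R : realType) d (x : 'M[R]_d.+1) : psd x ->
  exists r (A : 'M[R]_(r, d.+1)), x = A^T *m A.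
Proof.
case=> r [p [_ ->]]; exists r, (\matrix_i fcoef (tnth p i)).
apply/matrixP => i j; rewrite summxE !mxE; apply: eq_bigr => s _.
by rewrite !mxE.
Qed.

Definition conjmx (R : rcfType) n m (M : 'M[R[i]]_(n, m)) := map_mx (@conjc R) M.

Lemma hermitian_gram (R : rcfType) q n m (A : 'M[R]_(q, n)) (K : 'M[R[i]]_(n, m)) j :
  ((conjmx K)^T *m map_mx (real_complex R) (A^T *m A) *m K) j j =
  \sum_i (map_mx (real_complex R) A *m K) i j * ((map_mx (real_complex R) A *m K) i
    j)^*%C.
Proof.
set A' := map_mx _ A; have -> : map_mx (real_complex R) (A^T *m A) = A'^T *m A'.
  by rewrite map_mxM map_trmx.
have cA : conjmx A' = A' by apply/matrixP => x y; rewrite !mxE; exact: conjc_real.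
have E : A' *m conjmx K = conjmx (A' *m K) by rewrite /conjmx map_mxM -/(conjmx A') cA.
rewrite mulmxA -trmx_mul -mulmxA E mxE; apply: eq_bigr => i _.
by rewrite mulrC; congr (_ * _); rewrite !mxE.
Qed.

(** The diagonal entries of K^* M K are sums of squared moduli for both Gram matrices M. A
    combination of them with positive weights vanishes only if every summand does. *)
Lemma gram_kernel (R : rcfType) r s n m (A : 'M[R]_(r, n)) (B : 'M[R]_(s, n))
    (t : R) (K : 'M[R[i]]_(n, m)) : 0 < t < 1 ->
  map_mx (real_complex R) (t *: (A^T *m A) + (1 - t) *: (B^T *m B)) *m K = 0 ->
  map_mx (real_complex R) A *m K = 0.
Proof.
move=> /andP[t0 t1] K0; apply/matrixP => i j; rewrite [RHS]mxE.
have ge0 q (M : 'M[R]_(q, n)) :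
    0 <= ((conjmx K)^T *m map_mx (real_complex R) (M^T *m M) *m K) j j.
  by rewrite hermitian_gram; apply: sumr_ge0 => l _; exact: mulcJ_ge0.
have : ((conjmx K)^T *m map_mx (real_complex R)
    (t *: (A^T *m A) + (1 - t) *: (B^T *m B)) *m K) j j = 0.
  by rewrite -mulmxA K0 mulmx0 mxE.
rewrite map_mxD !map_mxZ mulmxDr mulmxDl -!scalemxAr -!scalemxAl.
rewrite mxE [X in X + _]mxE [X in _ + X]mxE => /eqP.
rewrite paddr_eq0 ?mulr_ge0 ?ge0 ?lecR ?subr_ge0 ?ltW //.
rewrite mulf_eq0 fmorph_eq0 (gt_eqF t0) /= hermitian_gram => /andP[+ _].
rewrite psumr_eq0 => [/allP/(_ i (mem_index_enum _))|l _]; last exact: mulcJ_ge0.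
by rewrite /= mulf_eq0 conjc_eq0 orbb => /eqP.
Qed.

Lemma outerE (A : nzRingType) n (v w : 'rV[A]_n) i j : (v^T *m w) i j = v 0 i * w 0 j.
Proof. by rewrite mxE big_ord1 mxE. Qed.

Lemma free_family (K : fieldType) (vT : vectType K) (T : finType) (g : T ->
  vT) (s : seq T) :
    (forall c : T -> K, \sum_x c x *: g x = 0 -> forall x, c x = 0) -> uniq s ->
  free [seq g x | x <- s].
Proof.
move=> g_free us; suff : free (map_tuple g (in_tuple s)) by [].
apply/freeP => c c0 i.
pose y := tnth (in_tuple s); have y_inj : injective y by apply/tuple_uniqP.
pose c' x := \sum_(j | y j == x) c j.
have c'0 : \sum_x c' x *: g x = 0.
  apply: etrans c0; rewrite [RHS](partition_big y predT) //=; apply: eq_bigr => x _.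
  rewrite scaler_suml; apply: eq_bigr => j /eqP <-; congr (_ *: _).
  by rewrite -(tnth_nth 0 (map_tuple g (in_tuple s))) tnth_map.
have := g_free _ c'0 (y i); rewrite /c' (big_pred1 i) // => j.
by rewrite (inj_eq y_inj).
Qed.

Lemma dim_family (K : fieldType) (vT : vectType K) (T : finType) (g : T -> vT) :
    (forall c : T -> K, \sum_x c x *: g x = 0 -> forall x, c x = 0) ->
  \dim <<[seq g x | x <- enum T]>> = #|T|.
Proof.
move=> /free_family/(_ (enum_uniq T))/eqnP ->.
by rewrite size_map -cardE.
Qed.

Lemma tensorZ (R : realType) d (c : R) (p : bform R d) :
  tensor (c *: p) (c *: p) = c ^+ 2 *: tensor p p.
Proof.
apply/matrixP => x y; rewrite [LHS]mxE [RHS]mxE [tensor p p _ _]mxE linearZ /=.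
by rewrite [X in X * _]mxE [X in _ * X]mxE mulrACA expr2.
Qed.

(** * The face attached to a nondegenerate factorization *)

Section Face.
Variables (R : realType) (k d : nat) (a : R) (l : nat -> bool ->
  R[i]) (f : bform R (2 * d)).
Hypothesis a_gt0 : 0 < a.
Hypothesis l_conj : forall j b, l j (~~ b) = ((l j b)^*)%C.
Hypothesis nd : nondegenerate k.+1 (half_product d l).
Hypothesis fE : map_poly (real_complex R) (rVpoly (fcoef f)) =
  a%:C%C *: (half_product d l 0 true * half_product d l 0 false).

Local Notation S := ('I_k.+1 * bool)%type.
Local Notation C := (real_complex R).

Let V (s : S) : 'rV[R[i]]_d.+1 := poly_rV (half_product d l s.1 s.2).

Let rVpoly_V s : rVpoly (V s) = half_product d l s.1 s.2.
Proof. by rewrite poly_rV_K // size_half_product. Qed.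

Let conj_V (i : 'I_k.+1) b j : V (i, ~~ b) 0 j = ((V (i, b) 0 j)^*)%C.
Proof.
rewrite !mxE /= [half_product d l i (~~ b)](_ : _ = map_poly conjc (half_product d l
  i b)) ?coef_map //.
by rewrite map_half_product; apply: eq_bigr => m _; rewrite addNb l_conj.
Qed.

(** Multiplying a linear relation by the factor s gives a relation between products in which v s is
    the coefficient of the square of that factor, and a square is never a conjugate pair. *)
Let half_product_free (v : S -> R[i]) : \sum_s v s *: half_product d l s.1 s.2 = 0 ->
  forall s, v s = 0.
Proof.
move=> v0 s; pose c x y := if y == s then v x else 0.
have c0 : \sum_x \sum_y c x y *: (half_product d l x.1 x.2 * half_product d l y.1
  y.2) = 0.
  transitivity ((\sum_s v s *: half_product d l s.1 s.2) * half_product d l s.1 s.2);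
    last by rewrite v0 mul0r.
  rewrite mulr_suml; apply: eq_bigr => x _.
  rewrite (bigD1 s) //= /c eqxx big1 => [|y /negPf ->]; last by rewrite scale0r.
  by rewrite addr0 -scalerAl.
have /(nd c0) : s != conj_index s by rewrite /conj_index; case: (s) => i [];
  rewrite xpair_eqE andbF.
by rewrite /c eqxx => /eqP; rewrite -mulr2n mulrn_eq0 => /eqP.
Qed.

Let V_free (v : S -> R[i]) : \sum_s v s *: V s = 0 -> forall s, v s = 0.
Proof.
move=> v0; apply: half_product_free; have := congr1 rVpoly v0;
  rewrite linear_sum linear0 => v0'.
by apply: etrans v0'; apply: eq_bigr => s _; rewrite linearZ /= rVpoly_V.
Qed.

Let Vm : 'M[R[i]]_(#|{: S}|, d.+1) := \matrix_r V (enum_val r).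

(** The vectors [W] are dual to the [V]; a matrix killed by the cokernel has its rows in the span of
    the [V] and is expanded with their help. *)
Let dual : exists W : S -> 'cV[R[i]]_d.+1,
  (forall s t, (V s *m W t) 0 0 = (s == t)%:R) /\
  forall (m : nat) (X : 'M[R[i]]_(m, d.+1)), X *m cokermx Vm = 0 ->
    X = \sum_s (X *m W s) *m V s.
Proof.
have free : row_free Vm.
  apply/inj_row_free => v vV; apply/rowP => r; rewrite mxE -[r]enum_valK.
  apply: (V_free (v := fun s => v 0 (enum_rank s))).
  apply: etrans vV; rewrite mulmx_sum_row (reindex _ (onW_bij _ (enum_val_bij {: S}))).
  by apply: eq_bigr => s _; rewrite enum_valK rowK.
have [W VW] := row_freeP free; exists (fun s => col (enum_rank s) W); split.
  move=> s t; have /matrixP/(_ (enum_rank s) (enum_rank t)) := VW.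
  rewrite mxE [in RHS]mxE (inj_eq enum_rank_inj) => <-; rewrite mxE;
    apply: eq_bigr => j _.
  by rewrite [Vm _ _]mxE enum_rankK [col _ _ _ _]mxE.
move=> m X X0; have /submxP[Y XE] : (X <= Vm)%MS by rewrite submxE X0.
rewrite (reindex _ (onW_bij _ (enum_val_bij {: S}))) /=.
transitivity (X *m W *m Vm); first by rewrite XE -(mulmxA Y) VW mulmx1.
apply/matrixP => i j; rewrite mxE summxE; apply: eq_bigr => r _.
rewrite [RHS]mxE big_ord1 enum_valK [Vm _ _]mxE; congr (_ * _).
by rewrite !mxE; apply: eq_bigr => m' _; rewrite mxE.
Qed.

Let u (i : 'I_k.+1) (b : bool) : 'rV[R]_d.+1 :=
  \row_j (if b then complex.Re (V (i, true) 0 j) else complex.Im (V (i, true) 0 j)).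

(** With g the i-th factor, a g g^* = a (Re g)^2 + a (Im g)^2; this is the corresponding rank two
    tensor. *)
Let theta (i : 'I_k.+1) : 'M[R]_d.+1 :=
  a *: ((u i true)^T *m u i true + (u i false)^T *m u i false).

Let map_theta i : map_mx C (theta i) = (a / 2)%:C%C *:
  ((V (i, true))^T *m V (i, false) + (V (i, false))^T *m V (i, true)).
Proof.
apply/matrixP => x y; rewrite mxE mxE mxE !outerE [RHS]mxE [X in _ = _ * X]mxE !outerE.
rewrite !(conj_V i true : forall j, V (i, false) 0 j = _) ![u _ _ _ _]mxE.
case: (V (i, true) 0 x) => p q; case: (V (i, true) 0 y) => p' q' /=.
apply/eqP; rewrite eq_complex; simpc; apply/andP; split; apply/eqP => /=; by field.
Qed.

Let mu_poly_theta i : mu_poly (theta i) = rVpoly (fcoef f).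
Proof.
apply: (@map_inj_poly _ _ C);
  [exact: complexI | exact: rmorph0 | rewrite map_mu_poly map_theta fE].
rewrite linearZ linearD /= !mu_poly_tensor !rVpoly_V /= [X in _ + X]mulrC -mulr2n
  -scaler_nat scalerA.
rewrite (half_product_pair d l i) -(half_product_pair d l 0) -(rmorph_nat C) -rmorphM
  divfK ?pnatr_eq0 //.
Qed.

Let u_free (c : 'I_k.+1 -> bool -> R) :
  \sum_i \sum_b c i b *: u i b = 0 -> forall i b, c i b = 0.
Proof.
move=> c0.
(* With w = Re w + i Im w, the sum of (c - i c') w and its conjugate is 2 (c Re w + c' Im w), so a
   real relation lifts to a relation between the [V]. *)
pose v (s : S) := if s.2 then (c s.1 true -i* c s.1 false)%C else (c s.1 true +i* c
  s.1 false)%C.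
have v0 : \sum_s v s *: V s = 0.
  transitivity (\sum_i \sum_b v (i, b) *: V (i, b)).
    by rewrite pair_big; apply: eq_bigr => -[].
  apply/rowP => j; rewrite [RHS]mxE;
    have := congr1 (fun w : 'rV[R]_d.+1 => (2 * w 0 j)%:C%C) c0;
    rewrite [(0 : 'rV__) _ _]mxE mulr0 summxE.
  rewrite mulr_sumr rmorph_sum rmorph0 => c0'; apply: etrans c0'.
  rewrite summxE; apply: eq_bigr => i _.
  have addE (A : nzRingType) (w w' : 'rV[A]_d.+1) x y : (x *: w + y *: w') 0 j = x *
    w 0 j + y * w' 0 j.
    by rewrite mxE [X in X + _]mxE [X in _ + X]mxE.
  rewrite !big_bool !addE ![u _ _ _ _]mxE /v /=.
  rewrite (conj_V i true); case: (V (i, true) 0 j) => p q /=.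
  apply/eqP; rewrite eq_complex; simpc; apply/andP; split; apply/eqP => /=; ring.
move=> i b; have := V_free v0 (i, true); rewrite /v /= => -[ct /eqP];
  rewrite oppr_eq0 => /eqP cf.
by case: b.
Qed.

Let Uv (i : 'I_k.+1) (b : bool) : bform R d := fpoly (u i b).

Let tensor_Uv i b : tensor (Uv i b) (Uv i b) = (u i b)^T *m u i b.
Proof. by apply/matrixP => x y; rewrite mxE outerE !fpolyK. Qed.

Let thetaE i : theta i = \sum_(j < 2) tensor (tnth [tuple Num.sqrt a *: Uv i true;
  Num.sqrt a *: Uv i false] j)
    (tnth [tuple Num.sqrt a *: Uv i true; Num.sqrt a *: Uv i false] j).
Proof.
by rewrite big_ord_recl big_ord1 /theta scalerDr -!tensor_Uv !tensorZ sqr_sqrtr // ltW.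
Qed.

Let pr (i : 'I_k.+1) : 'M[R[i]]_d.+1 :=
  (V (i, true))^T *m V (i, false) + (V (i, false))^T *m V (i, true).

(* T i is the hermitian form at the vector dual to V (i, true). *)
Let evaluations : exists T : 'I_k.+1 -> {scalar 'M[R[i]]_d.+1},
  (forall i j, T i (pr j) = (i == j)%:R) /\
  forall i r (A : 'M[R]_(r, d.+1)), 0 <= T i (map_mx C (A^T *m A)).
Proof.
have [W [VW _]] := dual.
pose T i (X : 'M[R[i]]_d.+1) := ((conjmx (W (i, true)))^T *m X *m W (i, true)) 0 0.
have linT i : scalar (T i).
  move=> c X Y; rewrite /T mulmxDr mulmxDl -scalemxAr -scalemxAl mxE [X in X + _]mxE //.
pose LT i : {scalar 'M[R[i]]_d.+1} :=
  HB.pack (T i) (GRing.isLinear.Build _ _ _ *%R (T i) (linT i)).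
exists LT; split => [i j|i r A]; last first.
  by rewrite /LT /= /T hermitian_gram; apply: sumr_ge0 => q _; exact: mulcJ_ge0.
have TV s t : T i ((V s)^T *m V t) = ((V s *m conjmx (W (i,
  true))) 0 0) * ((V t *m W (i, true)) 0 0).
  rewrite /T mulmxA -trmx_mul -mulmxA mxE big_ord1 [_^T _ _]mxE //.
have VcW b : (V (j, b) *m conjmx (W (i, true))) 0 0 = ((V (j, ~~ b) *m W (i,
  true)) 0 0)^*%C.
  rewrite mxE [in RHS]mxE rmorph_sum; apply: eq_bigr => q _; rewrite rmorphM /=.
  by rewrite -(conj_V j (~~ b)) negbK [conjmx _ _ _]mxE.
have -> : LT i (pr j) = T i ((V (j, true))^T *m V (j, false)) + T i ((V (j,
  false))^T *m V (j, true)).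
  exact: (raddfD (LT i)).
rewrite !TV !VcW !VW !xpair_eqE /= andbF !andbT mulr0 add0r.
by rewrite conjc_nat -natrM mulnb andbb eq_sym.
Qed.

Let p_neq0 : rVpoly (fcoef f) != 0.
Proof.
apply/eqP => p0; have := fE; rewrite p0 rmorph0 => /esym/eqP.
rewrite scaler_eq0 fmorph_eq0 (gt_eqF a_gt0) mulf_eq0 /=.
by rewrite !(negPf (half_product_neq0 _ _ _ _)).
Qed.

Let F := convex_hull theta.

(** The tensor is expanded in the products of the [V], with symmetric coefficients. Comparing its
    image with f gives a relation between products of factors, and nondegeneracy leaves only the
    conjugate pairs. *)
Let psd_expand r (A : 'M[R]_(r, d.+1)) : map_mx C A *m cokermx Vm = 0 ->
  mu_poly (A^T *m A) = rVpoly (fcoef f) ->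
  exists c : 'I_k.+1 -> R[i], map_mx C (A^T *m A) = \sum_i c i *: pr i.
Proof.
move=> AK Af; set X := map_mx C (A^T *m A); have [W [_ dualW]] := dual.
have XT : X^T = X by rewrite /X map_trmx trmx_mul trmxK.
have X0 : X *m cokermx Vm = 0 by rewrite /X map_mxM -mulmxA AK mulmx0.
have XE := dualW _ _ X0.
have XE' : X = \sum_s (V s)^T *m ((W s)^T *m X).
  rewrite -{1}XT {1}XE raddf_sum; apply: eq_bigr => s _.
  by rewrite /= !trmx_mul XT.
pose c s t := ((W s)^T *m X *m W t) 0 0.
have XC : X = \sum_s \sum_t c s t *: ((V s)^T *m V t).
  rewrite {1}XE exchange_big; apply: eq_bigr => t _ /=.
  rewrite {1}XE' !mulmx_suml; apply: eq_bigr => s _.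
  have HW : (W s)^T *m X *m W t = (c s t)%:M by rewrite [LHS]mx11_scalar.
  by rewrite -[_ *m W t]mulmxA HW mul_mx_scalar -scalemxAl.
have cC s t : c s t = c t s.
  transitivity (((W s)^T *m X *m W t)^T 0 0); first by rewrite [RHS]mxE.
  by rewrite !trmx_mul trmxK XT mulmxA.
(* Subtracting a at one conjugate pair over index 0 accounts for f and makes the relation
   homogeneous, without touching the non-conjugate coefficients. *)
pose c' s t := c s t - (if (s == (ord0, true)) && (t == (ord0,
  false)) then a%:C%C else 0).
have c'0 : \sum_s \sum_t c' s t *: (half_product d l s.1 s.2 * half_product d l t.1
  t.2) = 0.
  have := congr1 (map_poly C) Af; rewrite map_mu_poly -/X {1}XC fE.
  rewrite linear_sum => /eqP; rewrite -subr_eq0 => /eqP E; apply: etrans E.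
  under eq_bigr => s _ do (under eq_bigr => t _ do rewrite scalerBl; rewrite sumrB).
  rewrite sumrB; congr (_ - _).
    apply: eq_bigr => s _; rewrite linear_sum; apply: eq_bigr => t _.
    by rewrite linearZ /= mu_poly_tensor !rVpoly_V.
  rewrite (bigD1 (ord0, true)) //= (bigD1 (ord0, false)) //= big1 => [|t /negPf ->];
    last first.
    by rewrite scale0r.
  rewrite addr0 big1 ?addr0 // => s /negPf sn; rewrite big1 // => t _.
  by rewrite sn scale0r.
have cN s t : t != conj_index s -> c s t = 0.
  move=> st; have := nd c'0 st; rewrite /c' [c t s]cC.
  have n1 : (s == (ord0, true)) && (t == (ord0, false)) = false.
    by apply/negP => /andP[/eqP e1 /eqP e2]; rewrite e1 e2 /conj_index eqxx in st.
  have n2 : (t == (ord0, true)) && (s == (ord0, false)) = false.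
    by apply/negP => /andP[/eqP e1 /eqP e2]; rewrite e1 e2 /conj_index eqxx in st.
  by rewrite n1 n2 !subr0 => /eqP; rewrite -mulr2n mulrn_eq0 => /eqP.
exists (fun i => c (i, true) (i, false)); rewrite XC.
transitivity (\sum_s c s (conj_index s) *: ((V s)^T *m V (conj_index s))).
  apply: eq_bigr => s _; rewrite (bigD1 (conj_index s)) //= big1 ?addr0 // => t /cN ->.
  by rewrite scale0r.
transitivity (\sum_i \sum_b c (i, b) (i, ~~ b) *: ((V (i, b))^T *m V (i, ~~ b))).
  by rewrite pair_big; apply: eq_bigr => -[].
by apply: eq_bigr => i _; rewrite big_bool /= [c (i, false) _]cC scalerDr.
Qed.

(** By [gram_kernel] the image of x lies in the span of the [V], so x is a combination of the
    [theta i]. The weights are nonnegative by the hermitian evaluations, and they add up to 1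
    because every [theta i] is mapped to the nonzero f. *)
Let gram_face x y t (w : 'I_k.+1 -> R) : Gram f x -> Gram f y -> 0 < t < 1 ->
  t *: x + (1 - t) *: y = \sum_i w i *: theta i -> F x.
Proof.
move=> [_ /psd_gram[r [A xA]] fx] [_ /psd_gram[s [B yB]] _] t01 xy.
have AK : map_mx C A *m cokermx Vm = 0.
  apply: (gram_kernel (t := t) (B := B)) => //; rewrite -xA -yB xy.
  have VK s' : V s' *m cokermx Vm = 0.
    have := congr1 (row (enum_rank s')) (mulmx_coker Vm).
    by rewrite row_mul rowK enum_rankK row0.
  rewrite raddf_sum mulmx_suml big1 // => i _ /=.
  by rewrite map_mxZ map_theta -!scalemxAl mulmxDl -!mulmxA !VK !mulmx0 addr0 !scaler0.
have Af : mu_poly (A^T *m A) = rVpoly (fcoef f) by rewrite -xA; apply/mu_mu_poly.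
have [c xC] := psd_expand AK Af; have [T [Tpr Tge0]] := evaluations.
have Tc i : T i (map_mx C (A^T *m A)) = c i.
  rewrite xC linear_sum (bigD1 i) //= linearZ /= Tpr eqxx mulr1 big1 ?addr0 // => j ji.
  by rewrite linearZ /= Tpr eq_sym (negPf ji) mulr0.
have c_ge0 i : 0 <= c i by rewrite -Tc.
pose g i := complex.Re (c i);
  have cE i : c i = (g i)%:C%C by rewrite RRe_real // ger0_real.
have g_ge0 i : 0 <= g i by rewrite -lecR -cE.
have xE : x = \sum_i (2 * g i / a) *: theta i.
  apply: (map_mx_inj (f := C)); rewrite xA xC raddf_sum; apply: eq_bigr => i _ /=.
  rewrite map_mxZ map_theta -/(pr i) scalerA -rmorphM cE; congr (_%:C%C *: _).
  by field; rewrite gt_eqF.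
exists (fun i => 2 * g i / a); split=> // [i|].
  by rewrite mulr_ge0 ?mulr_ge0 // invr_ge0 ltW.
have := Af; rewrite -xA xE linear_sum;
  under eq_bigr do rewrite linearZ /= mu_poly_theta.
rewrite -scaler_suml => /eqP; rewrite -subr_eq0 -{2}[rVpoly _]scale1r -scalerBl.
by rewrite scaler_eq0 (negPf p_neq0) orbF subr_eq0 => /eqP.
Qed.

Let theta_free (w : 'I_k.+1 -> R) : \sum_i w i *: theta i = 0 -> forall i, w i = 0.
Proof.
move=> w0 i; have [T [Tpr _]] := evaluations.
have := congr1 (fun X => T i (map_mx C X)) w0.
rewrite raddf_sum raddf0 linear_sum linear0 (bigD1 i) //= big1 ?addr0 => [|j ji].
  rewrite map_mxZ map_theta scalerA linearZ /= -/(pr i) Tpr eqxx mulr1 -rmorphM.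
  move/eqP; rewrite fmorph_eq0 !mulf_eq0 invr_eq0 pnatr_eq0 (gt_eqF a_gt0) !orbF.
  by move/eqP.
by rewrite map_mxZ map_theta scalerA linearZ /= -/(pr j) Tpr eq_sym (negPf ji) mulr0.
Qed.

Let Uv_free (c : 'I_k.+1 -> bool -> R) :
  \sum_i \sum_b c i b *: Uv i b = 0 -> forall i b, c i b = 0.
Proof.
move=> c0; apply: u_free; have := congr1 (@fcoef R d) c0.
rewrite linear_sum linear0 => E; apply: etrans E; apply: eq_bigr => i _.
by rewrite linear_sum; apply: eq_bigr => b _; rewrite linearZ /= fpolyK.
Qed.

Let pt (i : 'I_k.+1) : 2.-tuple (bform R d) :=
  [tuple Num.sqrt a *: Uv i true; Num.sqrt a *: Uv i false].

Let sqrt_neq0 : Num.sqrt a != 0. Proof. by rewrite sqrtr_eq0 -ltNge. Qed.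

Let pt_free i : free (pt i).
Proof.
apply/freeP => c c0.
pose c' j b := if j == i then (if b then c ord0 else c (lift ord0 ord0)) * Num.sqrt a
  else 0.
have E : \sum_j \sum_b c' j b *: Uv j b = 0.
  rewrite (bigD1 i) //= [X in _ + X]big1 ?addr0 => [|j /negPf ji]; last first.
    by rewrite big1 // => b _; rewrite /c' ji scale0r.
  apply: etrans c0; rewrite big_ord_recl big_ord1 big_bool /c' eqxx /= !scalerA //.
move=> j; have h b : c' i b = 0 by apply: Uv_free.
have [-> | ->] : j = ord0 \/ j = lift ord0 ord0.
  by case: j => [[|[|j]] hj] //; [left | right]; apply/val_inj.
  by have /eqP := h true; rewrite /c' eqxx mulf_eq0 (negPf sqrt_neq0) orbF => /eqP.
by have /eqP := h false; rewrite /c' eqxx mulf_eq0 (negPf sqrt_neq0) orbF => /eqP.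
Qed.

Let im_theta i : im (theta i) = <<pt i>>%VS.
Proof.
rewrite thetaE -(@im_sum_tensor R d 2 (pt i) (fun=> 1)) ?pt_free //; last by left.
by congr (im _); apply: eq_bigr => j _; rewrite scale1r.
Qed.

Let UvS_free (c : S -> R) : \sum_s c s *: Uv s.1 s.2 = 0 -> forall s, c s = 0.
Proof.
move=> c0 [i b]; apply: (Uv_free (c := fun i b => c (i, b))); apply: etrans c0.
by rewrite pair_big; apply: eq_bigr => -[].
Qed.

Let psd_comb (w : 'I_k.+1 -> R) : (forall i, 0 <= w i) -> psd (\sum_i w i *: theta i).
Proof.
move=> w0; pose g (s : S) := Num.sqrt (w s.1 * a) *: Uv s.1 s.2.
(* [psd] asks for a free family, so the vectors of weight zero are discarded. *)
pose L := [seq s <- enum {: S} | w s.1 != 0];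
  exists (size [seq g s | s <- L]), (in_tuple [seq g s | s <- L]).
split.
  have -> : [seq g s | s <- L] = [seq (if w s.1 == 0 then 1 else Num.sqrt (w s.1 *
    a)) *: Uv s.1 s.2 | s <- L].
    by apply/eq_in_map => s; rewrite mem_filter /g => /andP[/negPf -> _].
  apply: free_family; last by rewrite filter_uniq ?enum_uniq.
  move=> c c0 s; have := UvS_free (c :=
    fun s => c s * (if w s.1 == 0 then 1 else Num.sqrt (w s.1 * a))).
  move=> /(_ _ s) h; have /eqP : c s * (if w s.1 == 0 then 1 else Num.sqrt (w s.1 *
    a)) = 0.
    by apply: h; apply: etrans c0; apply: eq_bigr => t _; rewrite scalerA.
  rewrite mulf_eq0 => /orP[/eqP//|]; case: (eqVneq (w s.1) 0) => [_|ws];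
    first by rewrite oner_eq0.
  by rewrite sqrtr_eq0 leNgt mulr_gt0 // lt_def ws w0.
rewrite -(big_tnth _ _ _ predT (fun v => tensor v v)) /= big_map big_filter
  big_enum_cond /=.
transitivity (\sum_(s : S) (w s.1 * a) *: ((u s.1 s.2)^T *m u s.1 s.2)).
  rewrite -(pair_big predT predT (fun i b => (w i * a) *: ((u i b)^T *m u i b))) /=.
  by apply: eq_bigr => i _; rewrite big_bool /= /theta scalerA scalerDr.
rewrite [LHS](bigID (fun s => w s.1 != 0)) /= [X in _ + X]big1 ?addr0 => [|s];
  last first.
  by rewrite negbK => /eqP ->; rewrite mul0r scale0r.
apply: eq_bigr => s _; rewrite -tensor_Uv /g.
by rewrite tensorZ sqr_sqrtr // mulr_ge0 // ltW.
Qed.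

Let F_Gram x : F x -> Gram f x.
Proof.
case=> w [w0 w1 ->]; split; last 1 first.
- apply/mu_mu_poly; rewrite linear_sum;
  under eq_bigr do rewrite linearZ /= mu_poly_theta.
  by rewrite -scaler_suml w1 scale1r.
- rewrite raddf_sum; apply: eq_bigr => i _.
  by rewrite /= linearZ /= /theta linearZ linearD /= !trmx_mul !trmxK.
exact: psd_comb.
Qed.

Let F_theta i : F (theta i).
Proof.
exists (fun j => (j == i)%:R); split=> [j||]; first by case: (j == i); rewrite ?ler01.
  by rewrite (bigD1 i) //= eqxx big1 ?addr0 // => j /negPf ->.
by rewrite (bigD1 i) //= eqxx scale1r big1 ?addr0 // => j /negPf ->; rewrite scale0r.
Qed.

Let F_convex : convex F.
Proof.
move=> _ _ t [w [w0 w1 ->]] [w' [w'0 w'1 ->]] /andP[t0 t1].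
exists (fun i => t * w i + (1 - t) * w' i); split=> [i||].
- by rewrite addr_ge0 ?mulr_ge0 ?subr_ge0.
- by rewrite big_split /= -!mulr_sumr w1 w'1 !mulr1 addrC subrK.
rewrite !scaler_sumr -big_split; apply: eq_bigr => i _.
by rewrite [RHS]scalerDl !scalerA.
Qed.

Let simplex_face : face (Gram f) F.
Proof.
split=> [x /F_Gram//|//|x y t Gx Gy t01 [w [w0 _ E]]]; split; first exact: gram_face E.
apply: (gram_face (x := y) (y := x) (t := 1 - t) (w := w)) => //.
  by case/andP: t01 => t0 t1; rewrite subr_gt0 t1 ltrBlDr ltrDl.
by rewrite subKr addrC.
Qed.

Let simplex_simplex : simplex F.
Proof. by exists k, theta; split=> // c _ /theta_free. Qed.

Let B : seq (bform R d) := [seq Uv s.1 s.2 | s <- enum {: S}].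

Let simplex_rk : face_rk F (2 * (k + 1))%N.
Proof.
exists <<B>>%VS; split; last first.
  by rewrite (dim_family UvS_free) card_prod card_ord card_bool mulnC addn1.
have UvU i b : Uv i b \in <<B>>%VS.
  by apply/memv_span/mapP; exists (i, b); rewrite ?mem_enum.
move=> x; split=> [xU|[s [sF xs]]].
  exists B; split=> // _ /mapP[[i b] _ ->].
  exists (theta i); split; first exact: F_theta.
  rewrite im_theta; have -> : Uv i b = (Num.sqrt a)^-1 *: (Num.sqrt a *: Uv i b).
    by rewrite scalerA mulVf ?scale1r.
  by apply/memvZ/memv_span; rewrite !inE; case: (b); rewrite eqxx ?orbT.
suff /subvP : (<<s>> <= <<B>>)%VS by apply.
apply/span_subvP => y /sF[_ [[w [_ _ ->]]]]; apply/subvP/span_subvP => _ /mapP[i _ ->].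
have -> : row i (\sum_j w j *: theta j) = \sum_j \sum_b (w j * a * u j b 0 i) *: u j b.
  apply/rowP => q; rewrite mxE !summxE; apply: eq_bigr => j _.
  rewrite big_bool /= /theta scalerA mxE [X in _ * X = _]mxE !outerE.
  by rewrite [RHS]mxE [X in _ = X + _]mxE [X in _ = _ + X]mxE mulrDr !mulrA.
rewrite linear_sum; apply: memv_suml => j _; rewrite linear_sum;
  apply: memv_suml => b _.
by rewrite linearZ; apply: memvZ; exact: UvU.
Qed.

Let simplex_dim : has_dim F k.
Proof.
split; first by exists (theta ord0); exact: F_theta.
pose D (i : 'I_k) := theta (lift ord0 i) - theta ord0.
have D_free (c : 'I_k -> R) : \sum_i c i *: D i = 0 -> forall i, c i = 0.
  move=> c0 i; pose w j := if unlift ord0 j is Some i then c i else - \sum_i c i.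
  have w0 : \sum_j w j *: theta j = 0.
    rewrite big_ord_recl /w unlift_none; under [X in _ + X]eq_bigr do rewrite liftK.
    apply: etrans c0; rewrite scaleNr scaler_suml addrC -sumrB.
    by apply: eq_bigr => j _; rewrite scalerBr.
  by have := theta_free w0 (lift ord0 i); rewrite /w liftK.
exists <<[seq D i | i <- enum 'I_k]>>%VS; split;
  last by rewrite (dim_family D_free) card_ord.
move=> x; split=> [xU|[s [sF xs]]].
  exists [seq D i | i <- enum 'I_k]; split=> // _ /mapP[i _ ->].
  by exists (theta (lift ord0 i)), (theta ord0); split=> //; exact: F_theta.
suff /subvP : (<<s>> <= <<[seq D i | i <- enum 'I_k]>>)%VS by apply.
apply/span_subvP => y /sF[_ [_ [[w [_ w1 ->]] [w' [_ w'1 ->]] ->]]].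
have -> : \sum_i w i *: theta i - \sum_i w' i *: theta i =
    \sum_(i < k) (w (lift ord0 i) - w' (lift ord0 i)) *: D i.
  have wE (v : 'I_k.+1 -> R) : \sum_i v i = 1 ->
      \sum_i v i *: theta i = theta ord0 + \sum_(i < k) v (lift ord0 i) *: D i.
    move=> v1; have v0 : v ord0 = 1 - \sum_(i < k) v (lift ord0 i).
      by rewrite -v1 big_ord_recl addrK.
    have -> : \sum_(i < k) v (lift ord0 i) *: D i = \sum_(i < k) v (lift ord0 i) *:
      theta (lift ord0 i) -
        (\sum_(i < k) v (lift ord0 i)) *: theta ord0.
      by rewrite scaler_suml -sumrB; apply: eq_bigr => i _; rewrite scalerBr.
    by rewrite big_ord_recl v0 scalerBl scale1r -addrA [- _ + _]addrC.
  rewrite (wE w) // (wE w') // opprD addrACA subrr add0r -sumrB.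
  by apply: eq_bigr => i _; rewrite -scalerBl.
apply: memv_suml => i _; apply/memvZ/memv_span/map_f.
by rewrite mem_enum.
Qed.

Let simplex_extreme x : extreme F x -> extreme (Gram f) x /\ rk x = 2%N.
Proof.
move=> [Fx xP]; split.
  split=> [|y z t Gy Gz t01 xE]; first exact: F_Gram.
  have [_ _ FP] := simplex_face.
  have [Fy Fz] : F y /\ F z by apply: (FP y z t); rewrite -?xE.
  exact: xP t01 xE.
suff [i ->] : exists i, x = theta i.
  by rewrite /rk im_theta; have /eqnP -> := pt_free i.
have [w [w0 w1 xE]] := Fx.
have [i wi] : exists i, 0 < w i.
  apply/existsP; rewrite -[[exists _, _]]negbK negb_exists; apply/negP => /forallP wN.
  have : \sum_i w i = 0 by rewrite big1 // => i _; apply/le_anti; rewrite w0 leNgt wN.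
  by rewrite w1 => /eqP; rewrite oner_eq0.
have w_le1 : w i <= 1 by rewrite -w1 (bigD1 i) //= lerDl sumr_ge0.
have wN1 : \sum_(j | j != i) w j = 1 - w i 
  by move: w1; rewrite (bigD1 i) //= => <-; rewrite addrAC subrr add0r.
exists i; move: w_le1; rewrite le_eqVlt => /orP[/eqP wi1|wi1].
  have wj j : j != i -> w j = 0.
    move=> ji; apply/eqP; have /eqP := wN1;
      rewrite wi1 subrr psumr_eq0 => [/allP/(_ j (mem_index_enum _))|? _ //].
    by rewrite ji.
  by rewrite xE (bigD1 i) //= wi1 scale1r big1 ?addr0 // => j /wj ->; rewrite scale0r.
(* If 0 < w i < 1, then x lies strictly between [theta i] and the renormalised rest y of the
   combination, so extremality gives x = [theta i]. *)
pose y := \sum_(j | j != i) (w j / (1 - w i)) *: theta j.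
have wi' : 1 - w i != 0 by rewrite subr_eq0 gt_eqF.
have Fy : F y.
  exists (fun j => if j == i then 0 else w j / (1 - w i)); split=> [j||].
  - by case: (j == i) => //; rewrite divr_ge0 ?subr_ge0 // ltW.
  - rewrite (bigD1 i) //= eqxx add0r (eq_bigr (fun j => w j / (1 - w i))) => [|j
    /negPf -> //].
    by rewrite -mulr_suml wN1 divff.
  rewrite (bigD1 i) //= eqxx scale0r add0r; apply: eq_bigr => j /negPf -> //.
have /(_ (theta i) y (w i) (F_theta i) Fy) := xP; case=> //; first by rewrite wi.
rewrite xE (bigD1 i) //=; congr (_ + _); rewrite /y scaler_sumr; apply: eq_bigr => j _.
by rewrite [RHS]scalerA mulrC divfK.
Qed.

Lemma exists_simplex_face : exists F : set 'M[R]_d.+1,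
  [/\ face (Gram f) F, simplex F, face_rk F (2 * (k + 1))%N, has_dim F k &
    forall x, extreme F x -> extreme (Gram f) x /\ rk x = 2%N].
Proof.
by exists F; split; [exact: simplex_face | exact: simplex_simplex | exact: simplex_rk |
  exact: simplex_dim | exact: simplex_extreme].
Qed.

End Face.

(** * Passage from generic polynomials to generic forms *)

Lemma generic_simplex_face (R : realType) (k d : nat) : (k.+1 ^ 2 <= d)%N ->
  generic_nonneg (fun f : bform R (2 * d)%N =>
    exists F : set 'M[R]_d.+1,
      [/\ face (Gram f) F, simplex F, face_rk F (2 * (k + 1))%N, has_dim F k &
        forall x, extreme F x -> extreme (Gram f) x /\ rk x = 2%N]).
Proof.
move=> hd; have [Q [sQ QP]] := generic_factorization R hd.
exists Q; split=> // f f_ge0 nP; apply/eqP/contraT => Qf; case: nP.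
have sp : (size (rVpoly (fcoef f)) <= (2 * d).+1)%N by exact: size_poly.
have p_ge0 x : 0 <= (rVpoly (fcoef f)).[x].
  (* The dehomogenization is the restriction of the form to the line y = 1. *)
  have := f_ge0 (fun i => if i == ord0 then x else 1).
  rewrite -{1}[f]fcoefK rVpolyE /= raddf_sum horner_sum.
  apply: etrans; congr (0 <= _); apply: eq_bigr => i _ /=;
    rewrite mevalZ hornerZ hornerXn mevalX; congr (_ * _).
  by rewrite big_ord_recl big_ord1 !mnmE /= expr1n mulr1.
have Qp : Q.@[fun i => (rVpoly (fcoef f))`_i] != 0.
  apply: contra_neq Qf => <-; apply: meval_eq => i; by rewrite coef_rVpoly_ord.
have [a [l [a_gt0 l_conj nd fE]]] := QP _ sp p_ge0 Qp.
exact: exists_simplex_face a_gt0 l_conj nd fE.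
Qed.

Local Close Scope ring_scope.

Theorem theorem4p12 (R : realType) (k d : nat)
  (hk : (0 < k)%N) (hd : ((k + 1) ^ 2 <= d)%N) :
  generic_nonneg (fun f : bform R (2 * d) =>
    exists F : set 'M[R]_d.+1,
      [/\ face (Gram f) F,
          simplex F,
          face_rk F (2 * (k + 1))%N,
          has_dim F k
        & forall theta : 'M[R]_d.+1, extreme F theta ->
            extreme (Gram f) theta /\ rk theta = 2%N]).
Proof. by apply: generic_simplex_face; rewrite -addn1. Qed.
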